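(* Let $v=v(x)$ satisfy the third Painlevé equation $$\frac{d^2v}{dx^2}=\frac{1}{v}\left(\frac{dv}{dx}\right)^2-\frac{1}{x}\frac{dv}{dx}+\frac{1}{x}\left(\alpha v^2+\beta\right)+\gamma v^3+\frac{\delta}{v},\qquad \gamma=-\delta=4,$$ with parameters written as $\alpha=-4\theta_\infty$, $\beta=4(\theta_0+1)$. Let $U_N(x,s)$, $N\in\mathbb{Z}$, be the polynomials in $x$ defined in the context. Then all the rational solutions of this equation are given as follows: 1. For any integer $N$, $$v=\frac{U_N(x,s-1)U_{N-1}(x,s)}{U_N(x,s)U_{N-1}(x,s-1)},\qquad v=-\frac{U_N(x,-s)U_{N-1}(x,-s-1)}{U_N(x,-s-1)U_{N-1}(x,-s)}$$ give two rational solutions with $(\theta_\infty,\theta_0)=(-s-N,-s+N-1)$. 2. For any integer $N$, $$v=i\,\frac{U_N(x/i,s-1)U_{N-1}(x/i,s)}{U_N(x/i,s)U_{N-1}(x/i,s-1)},\qquad v=-i\,\frac{U_N(x/i,-s)U_{N-1}(x/i,-s-1)}{U_N(x/i,-s-1)U_{N-1}(x/i,-s)}$$ give two rational solutions with $(\theta_\infty,\theta_0)=(s+N,-s+N-1)$. 3. For any integers $M$ and $N$, $$v=\frac{U_N(x,M-1)U_{N-1}(x,M)}{U_N(x,M)U_{N-1}(x,M-1)},\qquad v=-\frac{U_N(x,-M)U_{N-1}(x,-M-1)}{U_N(x,-M-1)U_{N-1}(x,-M)},$$ $$v=i\,\frac{U_M(x/i,-N)U_{M-1}(x/i,-N-1)}{U_M(x/i,-N-1)U_{M-1}(x/i,-N)},\qquad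 v=-i\,\frac{U_M(x/i,N-1)U_{M-1}(x/i,N)}{U_M(x/i,N)U_{M-1}(x/i,N-1)}$$ give four rational solutions with $(\theta_\infty,\theta_0)=(-M-N,-M+N-1)$.
   Context: Here $i=\sqrt{-1}$ and $s$ is a parameter. Polynomials $p_k(x,s)$ in $x$, $k\in\mathbb{Z}$, are defined by $\sum_{k=0}^\infty p_k(x,s)\lambda^k=(1+\lambda)^{s+1/2}e^{2x\lambda}$ and $p_k(x,s)=0$ for $k<0$. For $N\in\mathbb{Z}_{>0}$, $U_N(x,s)$ is the $N\times N$ determinant whose $(i,j)$ entry ($i,j=1,\dots,N$) is $p_{N-2i+j+1}(x,s)$ (so the first row is $p_N,\dots,p_{2N-1}$ and the last row is $p_{-N+2},\dots,p_1$); $U_0=1$; and for $N<0$, $U_N=(-1)^{N(N+1)/2}U_{-N-1}$. *)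

(* Defs.v *)
From HB Require Import structures.
From mathcomp Require Import all_boot all_order all_algebra.
From mathcomp Require Import fraction.
Set Implicit Arguments. Unset Strict Implicit. Unset Printing Implicit Defensive.
Import Order.TTheory GRing.Theory Num.Theory.
Local Open Scope ring_scope.

Local Notation "x %:F" := (@FracField.tofrac _ x).

Section P3.
Variable C : numClosedFieldType.

Definition gbinom (a : C) (j : nat) : C :=
  (\prod_(i < j) (a - i%:R)) / (j`!)%:R.

(* p_k(x,s) = [lambda^k] (1+lambda)^(s+1/2) e^(2 x lambda)
            = sum_{j=0}^k binom(s+1/2, j) (2x)^(k-j)/(k-j)! ,  and 0 for k<0 *)
Definition pk (k : int) (s : C) : {poly C} :=
  match k with
  | Posz k => \sum_(j < k.+1)
       (gbinom (s + 2^-1) j * 2 ^+ (k - j) / ((k - j)`!)%:R) *: 'X^(k - j)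
  | Negz _ => 0
  end.

(* U_N for N >= 0 : N x N determinant with (i,j) entry p_{N-2i+j+1}
   (1-based i,j), i.e. p_{N-2i+j} with 0-based i,j; U_0 = 1 (det of 0x0). *)
Definition Upos (n : nat) (s : C) : {poly C} :=
  \det (\matrix_(i < n, j < n) pk (n%:Z - 2 * i%:Z + j%:Z) s).

(* U_N for N in Z; for N = -n-1 < 0: U_N = (-1)^(N(N+1)/2) U_{-N-1},
   and N(N+1)/2 = n(n+1)/2. *)
Definition U (N : int) (s : C) : {poly C} :=
  match N with
  | Posz n => Upos n s
  | Negz n => (-1) ^+ ((n * n.+1) %/ 2) * Upos n s
  end.

Definition UF (N : int) (s : C) : {fraction {poly C}} := (U N s)%:F.
Definition UFi (N : int) (s : C) : {fraction {poly C}} :=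
  (U N s \Po ('i^-1 *: 'X))%:F.

Definition cF (c : C) : {fraction {poly C}} := (c%:P)%:F.
Definition xF : {fraction {poly C}} := ('X)%:F.

(* derivative d/dx on C(x), computed on a representative n/d:
   (n' d - n d') / d^2 (independent of the representative) *)
Definition fderiv (f : {fraction {poly C}}) : {fraction {poly C}} :=
  let r := repr f in
  ((\n_r)^`() * \d_r - \n_r * (\d_r)^`())%:F / ((\d_r) ^+ 2)%:F.

(* v is a (rational) solution of P_III with parameters alpha beta gamma delta:
   v'' = v'^2/v - v'/x + (alpha v^2 + beta)/x + gamma v^3 + delta/v ;
   v must be nonzero for the equation to make sense. *)
Definition PIII (alpha beta gamma delta : C) (v : {fraction {poly C}}) : Prop :=
  v != 0 /\
  fderiv (fderiv v) =
    (fderiv v) ^+ 2 / v - fderiv v / xF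
    + (cF alpha * v ^+ 2 + cF beta) / xF + cF gamma * v ^+ 3 + cF delta / v.

End P3.

(* Main.v *)
Require Import Defs.
From HB Require Import structures.
From mathcomp Require Import all_boot all_order all_algebra.
From mathcomp Require Import fraction.
From mathcomp Require Import generic_quotient separable ring zify.
Import Order.TTheory GRing.Theory Num.Theory.
Local Open Scope ring_scope.

(** For fixed N and s write a = U_N(s), b = U_N(s-1), c = U_(N-1)(s),
    d = U_(N-1)(s-1), A = U_(N+1)(s), B = U_(N+1)(s-1), z = 2x, ' = d/dz.

    Existence.  The columns (p_(N-2i+j)(s))_i of U_(N+1)(s) satisfy linear
    relations with cofactors as coefficients; applying to them the linear form
    "determinant with first column replaced", built from the p_k(s-1), and using
    p_k(s) = p_k(s-1) + p_(k-1)(s-1), only the extreme columns survive: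
      Ad = ab + cB,                aB = A(b + b') - A'b,
      Ab = a(B + B') - a'B,        (2N+1)Ad = (z + s + 1/2 + N)ab + z(ab' - a'b).
    The second and third identities (for N-1) say that rho = bc/(ad) satisfies
    rho = 1 + (log d/a)' and 1/rho = 1 + (log b/c)'; differentiating the fourth
    then gives Painleve III for rho.  The other families follow from
    v -> -v, v -> 1/v and x -> x/i, and negative N from v -> 1/v.

    Classification.  A rational solution v tends at infinity to some c with
    c^4 = 1, and two solutions with the same parameters and the same c coincide,
    since the equation linearised at infinity has the nonzero coefficient 16 c^2.
    At its nonzero poles v has residues +-1/2, so if 0 is not a pole then
    2(v - c) is a logarithmic derivative and 2x(v - c) tends to an integer k;
    comparing 1/x terms, alpha + beta c^2 = -8k.  If 0 is a pole, use 1/v.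
    This integer is the N of the theorem. *)

Set Implicit Arguments. Unset Strict Implicit. Unset Printing Implicit Defensive.

Local Notation "x %:F" := (@FracField.tofrac _ x).

(** * The polynomials p_k *)

Section Pk.
Variable C : numClosedFieldType.
Implicit Types (s a : C) (k : int) (m n j : nat).

Lemma gbinom0 a : gbinom a 0 = 1.
Proof. by rewrite /gbinom big_ord0 fact0 divr1. Qed.

Lemma gbinomS a j : gbinom a j.+1 * j.+1%:R = a * gbinom (a - 1) j.
Proof.
have h i : i`!%:R != 0 :> C by rewrite pnatr_eq0 -lt0n fact_gt0.
have h1 : j.+1%:R != 0 :> C by rewrite pnatr_eq0.
rewrite /gbinom big_ord_recl /= subr0 factS natrM.
have -> : \prod_(i < j) (a - (bump 0 i)%:R) = \prod_(i < j) (a - 1 - i%:R).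
  by apply: eq_bigr => i _; rewrite /bump /= add1n -natr1; ring.
move: h1 (h j).
by move: (\prod_(_ < _) _) (j`!%:R) (j.+1%:R) => x y z h1 h2; field; rewrite h1 h2.
Qed.

Lemma gbinom_recr a j : gbinom a j.+1 * j.+1%:R = gbinom a j * (a - j%:R).
Proof.
have h i : i`!%:R != 0 :> C by rewrite pnatr_eq0 -lt0n fact_gt0.
have h1 : j.+1%:R != 0 :> C by rewrite pnatr_eq0.
rewrite /gbinom big_ord_recr /= factS natrM; move: h1 (h j).
by move: (\prod_(_ < _) _) (j`!%:R) (j.+1%:R) => x y z h1 h2; field; rewrite h1 h2.
Qed.

Lemma gbinom_pascal a j : gbinom a j.+1 = gbinom (a - 1) j.+1 + gbinom (a - 1) j.
Proof.
have h1 : j.+1%:R != 0 :> C by rewrite pnatr_eq0.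
apply: (mulIf h1); rewrite gbinomS mulrDl gbinom_recr -natr1; ring.
Qed.

(** The test m <= k makes one formula valid for every integer k: it fails for all m when k < 0. *)
Definition pcoef k s m : C :=
  if (m%:Z <= k) then gbinom (s + 2^-1) (absz (k - m%:Z)%R) * 2 ^+ m / m`!%:R else 0.

Lemma coef_pk k s m : (pk k s)`_m = pcoef k s m.
Proof.
rewrite /pcoef; case: k => k /=; last by rewrite coef0.
rewrite coef_sum lez_nat.
under eq_bigr do rewrite coefZ coefXn.
case: leqP => hm; last first.
  by rewrite big1 // => i _; case: eqP => [|_]; [move: (ltn_ord i); lia | rewrite mulr0].
have hk : (k - m < k.+1)%N by lia.
rewrite (bigD1 (Ordinal hk)) //= big1 => [|i].
  rewrite subKn // eqxx mulr1 addr0.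
  by have -> : (absz (Posz k - Posz m)%R) = (k - m)%N by lia.
rewrite -val_eqE /= => hi; case: eqP => [|_]; last by rewrite mulr0.
by move: (ltn_ord i) hi; lia.
Qed.

Lemma pk_neg k s : k < 0 -> pk k s = 0.
Proof. by case: k. Qed.

Lemma pk0 s : pk 0 s = 1.
Proof. by rewrite /= big_ord1 gbinom0 fact0 !expr0 divr1 mulr1 scale1r. Qed.

(** Differentiation in x multiplies the generating function by 2 lambda. *)
Lemma deriv_pk k s : (pk k s)^`() = 2 * pk (k - 1) s.
Proof.
apply/polyP => m; rewrite coef_deriv -polyC1 -polyCMn coefCM !coef_pk /pcoef.
have -> : (m%:Z <= k - 1) = (m.+1%:Z <= k) by lia.
case: ifP => _; last by rewrite mul0rn mulr0.
have -> : (absz (k - m.+1%:Z)%R) = (absz (k - 1 - m%:Z)%R) by lia.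
have h : m`!%:R != 0 :> C by rewrite pnatr_eq0 -lt0n fact_gt0.
have h1 : m.+1%:R != 0 :> C by rewrite pnatr_eq0.
rewrite -[LHS]mulr_natr exprS factS natrM; move: h h1.
move: (gbinom _ _) (2 ^+ m : C) (m`!%:R : C) (m.+1%:R : C) => x y z t h h1.
by field; rewrite h h1.
Qed.

(** One factor 1 + lambda is split off from (1 + lambda)^(s+1/2); on coefficients this is Pascal's
    rule. *)
Lemma pk_shift k s : pk k s = pk k (s - 1) + pk (k - 1) (s - 1).
Proof.
apply/polyP => m; rewrite coefD !coef_pk /pcoef.
have -> : s - 1 + 2^-1 = s + 2^-1 - 1 by rewrite addrAC.
move: (s + 2^-1) => a.
have [hk|hk|hk] := ltrgtP m%:Z k.
- have -> : (m%:Z <= k - 1) by lia.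
  have -> : (absz (k - m%:Z)%R) = (absz (k - 1 - m%:Z)%R).+1 by lia.
  by rewrite gbinom_pascal !mulrDl.
- by rewrite ifN ?addr0 //; lia.
- rewrite ifN ?addr0; last by lia.
  have -> : absz (k - m%:Z)%R = 0%N by lia.
  by rewrite !gbinom0.
Qed.

(* Compare coefficients of lambda^k in lambda G', G = (1+lambda)^(s+1/2) e^(2x lambda). *)
Lemma pk_euler k s : k%:~R * pk k s =
  ((s + 2^-1)%:P + 2 * 'X) * pk (k - 1) (s - 1) + 2 * 'X * pk (k - 2) (s - 1).
Proof.
(* By [pk_shift] the terms carrying 2x add up to 2x p_(k-1)(s). *)
have -> : ((s + 2^-1)%:P + 2 * 'X) * pk (k - 1) (s - 1) + 2 * 'X * pk (k - 2) (s - 1)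
  = (s + 2^-1)%:P * pk (k - 1) (s - 1) + 2%:P * ('X * pk (k - 1) s).
  by rewrite (pk_shift (k - 1) s) -addrA -[-1 - 1]/(-2%:Z) polyCMn; ring.
apply/polyP => m.
have -> : k%:~R = (k%:~R)%:P :> {poly C} by rewrite rmorph_int.
rewrite coefD !coefCM coefXM !coef_pk /pcoef.
have -> : s - 1 + 2^-1 = s + 2^-1 - 1 by rewrite addrAC.
move: (s + 2^-1) => a.
have h i : i`!%:R != 0 :> C by rewrite pnatr_eq0 -lt0n fact_gt0.
have -> : (m%:Z <= k - 1) = (m%:Z < k) by lia.
(* This is (k-m) binom(a,k-m) = a binom(a-1,k-m-1). The other summand of k = (k-m) + m accounts for
   2x p_(k-1)(s). *)
have first : (if (m%:Z <= k) then ((k - m%:Z)%:~R : C) * gbinom a (absz (k - m%:Z)%R) * 2 ^+ m / m`!%:R else 0)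
  = a * (if m%:Z < k then gbinom (a - 1) (absz (k - 1 - m%:Z)%R) * 2 ^+ m / m`!%:R else 0).
  have [hk|hk|hk] := ltrgtP m%:Z k; last by rewrite hk subrr !mul0r mulr0.
  - have e : (absz (k - m%:Z)%R) = (absz (k - 1 - m%:Z)%R).+1 by lia.
    have -> : k - m%:Z = (absz (k - 1 - m%:Z)%R).+1%:Z by lia.
    by rewrite absz_nat -pmulrn [_%:R * _]mulrC gbinomS -!mulrA.
  - by rewrite mulr0.
rewrite -{}first; case: m => [|m] /=.
  have -> : k - 0%:Z = k by lia.
  rewrite mulr0 addr0; case: ifP => _; last by rewrite mulr0.
  by rewrite !mulrA.
have -> : (m%:Z <= k - 1) = (m.+1%:Z <= k) by lia.
case: ifP => _; last by rewrite !mulr0 addr0.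
have -> : (absz (k - 1 - m%:Z)%R) = (absz (k - m.+1%:Z)%R) by lia.
have e : k%:~R = (k - m.+1%:Z)%:~R + m.+1%:R :> C.
  by rewrite -[X in _ + X]/((m.+1%:Z)%:~R) -rmorphD /= subrK.
have h1 : m.+1%:R != 0 :> C by rewrite pnatr_eq0.
rewrite e exprS factS natrM; move: (h m) h1.
move: (gbinom _ _) (2 ^+ m : C) (m`!%:R : C) (m.+1%:R : C) ((_ : int)%:~R : C) => x y z t u h0 h1.
by field; rewrite h0 h1.
Qed.

End Pk.

(** * Bilinear relations between the determinants *)

Lemma deriv_prod (R : comNzRingType) (I : finType) (F : I -> {poly R}) :
  (\prod_i F i)^`() = \sum_k (F k)^`() * \prod_(i | i != k) F i.
Proof.
(* In a duplicate-free sequence the condition i != k removes exactly one factor. *)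
have H (r : seq I) : uniq r -> (\prod_(i <- r) F i)^`() =
    \sum_(k <- r) (F k)^`() * \prod_(i <- r | i != k) F i.
  elim: r => [|x r IH]; first by rewrite !big_nil derivC.
  case/andP=> xr ur; rewrite !big_cons derivM (IH ur) eqxx /=; congr (_ * _ + _).
    rewrite big_seq [RHS]big_seq_cond; apply: eq_bigl => i.
    by case: (boolP (i \in r)) => //= ir; case: eqP ir xr => // -> ->.
  rewrite big_distrr /= big_seq [RHS]big_seq; apply: eq_bigr => k kr.
  rewrite big_cons ifT; last by apply: contraNneq xr => ->.
  by rewrite mulrCA.
rewrite -[LHS]/((\prod_(i in I) F i)^`()) -big_enum H ?enum_uniq // big_enum /=.
by apply: eq_bigr => k _; rewrite big_enum_cond /=.
Qed.

(** Jacobi's formula: the derivative is the sum over k of the determinants with row k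
    differentiated, each of which is expanded along that row. *)
Lemma deriv_det (R : comNzRingType) n (A : 'M[{poly R}]_n) :
  (\det A)^`() = \sum_i \sum_j (A i j)^`() * cofactor A i j.
Proof.
pose B k := \matrix_(i, j) if i == k then (A i j)^`() else A i j.
transitivity (\sum_k \det (B k)).
  rewrite /determinant exchange_big /= raddf_sum /=; apply: eq_bigr => s _.
  rewrite derivM -signr_odd -polyC1 -polyCN -polyC_exp derivC mul0r add0r.
  rewrite deriv_prod big_distrr /=; apply: eq_bigr => k _; congr (_ * _).
  rewrite [RHS](bigD1 k) //= mxE eqxx; congr (_ * _).
  by apply: eq_bigr => i /negbTE ik; rewrite mxE ik.
apply: eq_bigr => k _; rewrite (expand_det_row _ k); apply: eq_bigr => j _.
rewrite mxE eqxx; congr (_ * (_ * \det _)).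
by apply/matrixP => a b; rewrite !mxE eq_sym (negbTE (neq_lift _ _)).
Qed.

(** * Staircase determinants and the replacement of their first column *)

Section Frame.
Variable C : numClosedFieldType.
Implicit Types (s : C) (k q : int) (n : nat).

(** The corner index k is independent of the size n, so that minors and column shifts of U_n keep
    the same shape. *)
Definition staircase n k s : 'M[{poly C}]_n :=
  \matrix_(i < n, j < n) pk (k - 2 * i%:Z + j%:Z) s.

Lemma UposE n s : Upos n s = \det (staircase n n%:Z s).
Proof. by []. Qed.

Lemma minor00 n k s : row' 0 (col' 0 (staircase n.+1 k s)) = staircase n (k - 1) s.
Proof. by apply/matrixP => i j; rewrite !mxE; congr (pk _ _); rewrite !lift0; lia. Qed.

(** Raising k by one moves every column one place to the left, so both sides retain the same
    columns. *)
Lemma minor_shift n k s (i : 'I_n.+1) :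
  row' i (col' ord_max (staircase n.+1 (k + 1) s)) = row' i (col' 0 (staircase n.+1 k s)).
Proof.
apply/matrixP => a b; rewrite !mxE; congr (pk _ _).
by rewrite lift_max lift0; lia.
Qed.

Lemma minor_last n k s :
  row' ord_max (col' ord_max (staircase n.+1 k s)) = staircase n k s.
Proof. by apply/matrixP => i j; rewrite !mxE !lift_max. Qed.

(** The last row is p_(-n), ..., p_0, that is 0, ..., 0, 1. *)
Lemma det_staircase_last n s : \det (staircase n.+1 n%:Z s) = Upos n s.
Proof.
rewrite (expand_det_row _ ord_max) (bigD1 ord_max) //= big1 => [|j jn].
  rewrite addr0 mxE /cofactor minor_last -signr_odd addnn odd_double mul1r.
  by rewrite (_ : _ + _ = 0) ?pk0 ?mul1r //=; lia.
rewrite mxE pk_neg ?mul0r //=.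
by move: (ltn_ord j); rewrite -val_eqE /= in jn *; lia.
Qed.

(** The determinant of [staircase n.+1 k s] with its first column replaced by the column that the
    same formula gives for j = q, where q may lie outside the matrix. *)
Definition colfun n k s q : {poly C} :=
  \sum_i cofactor (staircase n.+1 k s) i 0 * pk (k - 2 * i%:Z + q) s.

Lemma colfun_ord n k s (j : 'I_n.+1) :
  colfun n k s j%:Z = if j == 0 then \det (staircase n.+1 k s) else 0.
Proof.
have /matrixP/(_ 0 j) := mul_adj_mx (staircase n.+1 k s).
rewrite mxE [RHS]mxE [0 == _]eq_sym mulrb => <-.
by apply: eq_bigr => i _; rewrite !mxE.
Qed.

Lemma colfun0 n k s : colfun n k s 0 = \det (staircase n.+1 k s).
Proof. by have := @colfun_ord n k s 0; rewrite eqxx. Qed.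

Lemma colfun_mid n k s (j : nat) : (0 < j <= n)%N -> colfun n k s j%:Z = 0.
Proof.
case/andP=> j0 jn; have := @colfun_ord n k s (inord j).
by rewrite inordK // -val_eqE /= inordK // gtn_eqF.
Qed.

(** Column n+1 stands in the first place; moving it behind the n remaining columns costs the sign
    and gives the matrix with k+1. *)
Lemma colfun_last n k s :
  colfun n k s n.+1%:Z = (-1) ^+ n * \det (staircase n.+1 (k + 1) s).
Proof.
rewrite (expand_det_col _ ord_max) big_distrr; apply: eq_bigr => i _ /=.
rewrite mxE /cofactor minor_shift /= addn0 exprD.
have -> : k - 2 * i%:Z + n.+1%:Z = k + 1 - 2 * i%:Z + n%:Z by lia.
have h : (-1) ^+ n * (-1) ^+ n = 1 :> {poly C} by rewrite -expr2 sqrr_sign.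
move: (\det _) (pk _ _) ((-1) ^+ i) h => d p e h.
by ring: h.
Qed.

(** The derivative of column j is twice column j-1, already present unless j = 0; so only the first
    column contributes, with q = -1. *)
Lemma deriv_staircase n k s :
  (\det (staircase n.+1 k s))^`() = 2 * colfun n k s (-1).
Proof.
rewrite deriv_det exchange_big /= big_ord_recl /= [X in _ + X]big1 => [|j _].
  rewrite addr0 /colfun big_distrr /=. apply: eq_bigr => i _ /=.
  by rewrite mxE deriv_pk mulrC mulrCA addr0.
(* An off-diagonal entry of adjugate times matrix is zero: column j+1 has been replaced by a copy of
   column j. *)
have /matrixP/(_ (lift 0 j) (inord j)) := mul_adj_mx (staircase n.+1 k s).
rewrite !mxE (_ : _ == _ = false) ?mulr0n => [h|]; last first.
  by rewrite -val_eqE /= inordK ?bump0 //; [rewrite gtn_eqF // lift0 | rewrite ltnS ltnW].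
transitivity (2 * \sum_i (\adj (staircase n.+1 k s)) (lift 0 j) i
                          * staircase n.+1 k s i (inord j)); last by rewrite h mulr0.
rewrite big_distrr; apply: eq_bigr => i _ /=.
rewrite !mxE deriv_pk -mulrA; congr (_ * _); rewrite mulrC; congr (_ * pk _ _).
by rewrite lift0 inordK; [lia | rewrite ltnS ltnW].
Qed.

End Frame.

(** * The four bilinear relations for consecutive sizes *)

Section Bilinear.
Variable C : numClosedFieldType.
Implicit Types (s : C) (k q : int) (n : nat).

Lemma det_staircase_pred n s : \det (staircase n (n%:Z - 1) s) = Upos n.-1 s.
Proof.
(* For n = 0 the predecessor is 0 as well, and both determinants are empty. *)
case: n => [|n]; first by rewrite /Upos !det_mx00.
by rewrite (_ : _ - 1 = n%:Z) ?det_staircase_last //; lia.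
Qed.

Section Size.
Variables (n : nat) (s : C).
Let a := Upos n s.
Let b := Upos n (s - 1).
Let c := Upos n.-1 s.
Let d := Upos n.-1 (s - 1).
Let A := Upos n.+1 s.
Let B := Upos n.+1 (s - 1).
Let M := staircase n.+1 n.+1%:Z s.
(** First-row cofactors: as coefficients of the columns of [M] they annihilate every row but the
    first, where they give A. *)
Let u (j : 'I_n.+1) : {poly C} := cofactor M 0 j.

Lemma u_first : u 0 = a.
Proof.
rewrite /u /cofactor minor00 expr0 mul1r /a UposE.
by rewrite (_ : _ - 1 = n%:Z) //; lia.
Qed.

Lemma u_last : u ord_max = (-1) ^+ n * c.
Proof.
rewrite /u /cofactor /M (_ : n.+1%:Z = n%:Z + 1); last by lia.
by rewrite minor_shift minor00 det_staircase_pred.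
Qed.

Lemma sum_u_first X : \sum_j u j * (if j == 0 :> nat then X else 0) = a * X.
Proof.
rewrite big_ord_recl /= u_first big1 ?addr0 // => j _.
by rewrite mulr0.
Qed.

Lemma sum_u_last X : \sum_j u j * (if j == n :> nat then X else 0) = (-1) ^+ n * c * X.
Proof.
rewrite (bigD1 ord_max) //= u_last eqxx big1 ?addr0 // => j.
by rewrite -val_eqE /= => /negbTE ->; rewrite mulr0.
Qed.

(** The minor without row 0 and column 1 is a with its first column replaced by column -1, hence
    a'/2; its cofactor sign is negative. For n = 0 there is no column 1 and a is constant. *)
Lemma sum_u_second X : 2 * (\sum_j u j * (if j == 1 :> nat then X else 0)) = - a^`() * X.
Proof.
rewrite /u /M /a; case: (n) => [|m].
  by rewrite big_ord1 /= mulr0 mulr0 /Upos det_mx00 derivC oppr0 mul0r.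
rewrite 2!big_ord_recl /= !mulr0 !add0r big1 => [|j _]; last by rewrite mulr0.
rewrite addr0 mulrA; congr (_ * _).
rewrite UposE deriv_staircase -mulrN; congr (_ * _).
rewrite /cofactor /= add0n expr1 mulN1r; congr (- _).
rewrite (expand_det_col _ 0); apply: eq_bigr => i _.
rewrite mulrC; congr (_ * _).
  congr (_ * \det _); apply/matrixP => x y; rewrite !mxE; congr (pk _ _).
  by rewrite !lift0 /= /bump /=; lia.
by rewrite !mxE; congr (pk _ _); rewrite !lift0 /= /bump /=; lia.
Qed.

Lemma sum_u_row (i : 'I_n.+1) :
  \sum_j u j * pk (n.+1%:Z - 2 * i%:Z + j%:Z) s = if i == 0 then A else 0.
Proof.
have /matrixP/(_ i 0) := mul_mx_adj M.
rewrite mxE [RHS]mxE mulrb /A UposE => <-.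
by apply: eq_bigr => j _; rewrite !mxE mulrC.
Qed.

(** Exchanging the sums leaves the row i = 0 only. A relation results from each [w] whose inner sums
    can be evaluated in another way. *)
Lemma double_sum (w : 'I_n.+1 -> {poly C}) :
  \sum_j u j * (\sum_i w i * pk (n.+1%:Z - 2 * i%:Z + j%:Z) s) = A * w 0.
Proof.
transitivity (\sum_i w i * (if i == 0 then A else 0)).
  under eq_bigr do rewrite big_distrr /=.
  rewrite exchange_big; apply: eq_bigr => i _ /=.
  by rewrite -sum_u_row big_distrr; apply: eq_bigr => j _; rewrite /= mulrCA.
rewrite (bigD1 0) //= big1 => [|i /negbTE ->]; last by rewrite mulr0.
by rewrite addr0 mulrC.
Qed.

(** Here b is written as a determinant of size n+1 with k = n, so that its cofactors pair with the
    n+1 rows of [M]. *)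
Let cof (i : 'I_n.+1) : {poly C} := cofactor (staircase n.+1 n%:Z (s - 1)) i 0.
Let h := colfun n n%:Z (s - 1).

Lemma cof_first : cof 0 = d.
Proof. by rewrite /cof /cofactor minor00 expr0 mul1r det_staircase_pred. Qed.

Lemma h_ord (j : 'I_n.+1) : h j%:Z = if j == 0 :> nat then b else 0.
Proof. by rewrite /h colfun_ord det_staircase_last -val_eqE. Qed.

Lemma h_succ (j : 'I_n.+1) :
  h (j%:Z + 1) = if j == n :> nat then (-1) ^+ n * B else 0.
Proof.
have -> : j%:Z + 1 = j.+1%:Z by lia.
case: eqP => [->|jn].
  by rewrite /h colfun_last (_ : n%:Z + 1 = n.+1%:Z) -?UposE //; lia.
by apply: colfun_mid; move: (ltn_ord j); lia.
Qed.

Lemma h_pred (j : 'I_n.+1) : h (j%:Z - 1) =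
  (if j == 0 :> nat then h (-1) else 0) + (if j == 1 :> nat then b else 0).
Proof.
case: j => -[|[|j]] jn /=; first by rewrite addr0.
  by rewrite add0r subrr /h colfun0 det_staircase_last.
rewrite addr0 (_ : _ - 1 = j.+1%:Z); last by lia.
by apply: colfun_mid; lia.
Qed.

Lemma h_deriv : 2 * h (-1) = b^`().
Proof. by rewrite -deriv_staircase det_staircase_last. Qed.

(** By [pk_shift] an entry at s is the sum of the entries at s-1 in columns j+1 and j, so the sum is
    h(j+1) + h(j). *)
Lemma sum_cof_pk (j : 'I_n.+1) :
  \sum_i cof i * pk (n.+1%:Z - 2 * i%:Z + j%:Z) s =
  (if j == n :> nat then (-1) ^+ n * B else 0) + (if j == 0 :> nat then b else 0).
Proof.
rewrite -h_succ -h_ord -big_split; apply: eq_bigr => i _ /=.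
by rewrite pk_shift mulrDr; congr (_ * pk _ _ + _ * pk _ _); lia.
Qed.

(** The weight n-2i equals k-(j+1), where k is the index of the entry it multiplies: [pk_euler]
    treats k, and [sum_cof_pk] treats j+1. *)
Lemma sum_cof_euler (j : 'I_n.+1) :
  \sum_i (cof i * (n%:Z - 2 * i%:Z)%:~R) * pk (n.+1%:Z - 2 * i%:Z + j%:Z) s =
  ((s + 2^-1)%:P + 2 * 'X) * h j%:Z + 2 * 'X * h (j%:Z - 1)
  - j.+1%:R * ((if j == n :> nat then (-1) ^+ n * B else 0)
               + (if j == 0 :> nat then b else 0)).
Proof.
rewrite -sum_cof_pk !big_distrr /= -big_split -sumrB; apply: eq_bigr => i _ /=.
set k := n.+1%:Z - _ + _.
have -> : (n%:Z - 2 * i%:Z)%:~R = k%:~R - j.+1%:R :> {poly C}.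
  by rewrite -[j.+1%:R]/((j.+1%:Z)%:~R) -rmorphB /=; congr (_%:~R); rewrite /k; lia.
rewrite mulrBr mulrBl -[_ * k%:~R * _]mulrA pk_euler mulrDr.
have -> : n%:Z - 2 * i%:Z + j%:Z = k - 1 by rewrite /k; lia.
have -> : n%:Z - 2 * i%:Z + (j%:Z - 1) = k - 2 by rewrite /k; lia.
by rewrite -/(cof i); ring.
Qed.

Lemma sign_sq : (-1) ^+ n * (-1) ^+ n = 1 :> {poly C}.
Proof. by rewrite -expr2 sqrr_sign. Qed.

(** This is [double_sum] for w = [cof]: the column j = 0 gives ab, the column j = n gives cB. *)
Lemma Upos_plucker : A * d = a * b + c * B.
Proof.
rewrite -cof_first -double_sum.
under eq_bigr do rewrite sum_cof_pk mulrDr.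
rewrite big_split /= sum_u_last sum_u_first.
by ring: sign_sq.
Qed.

(** This is [double_sum] for [cof] weighted by n-2i, after cB has been eliminated with
    [Upos_plucker]. *)
Lemma Upos_euler : (n.*2.+1)%:R * (A * d) =
  ((s + 2^-1 + n%:R)%:P + 2 * 'X) * (a * b) + 'X * (a * b^`() - a^`() * b).
Proof.
pose w i := cof i * (n%:Z - 2 * i%:Z)%:~R.
have w0 : w 0 = d * n%:R by rewrite /w cof_first mulr0 subr0.
have := double_sum w; rewrite {}w0 /w.
under eq_bigr do rewrite sum_cof_euler h_ord h_pred.
move=> E; have D := h_deriv; have V := Upos_plucker; have S2 := sum_u_second b.
have S1 := sum_u_first; have Sn := sum_u_last; have sgn := sign_sq.
clearbody a b c d A B h u; clear w.
(* The factor j+1 equals 1 at the first column and n+1 at the last. *)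
have F : \sum_j u j * ((j.+1)%:R * ((if j == n :> nat then (-1) ^+ n * B else 0)
               + (if j == 0 :> nat then b else 0))) = a * b + n.+1%:R * (c * B).
  under eq_bigr do rewrite mulrDr mulrDr.
  rewrite big_split /= addrC; congr (_ + _).
    rewrite -S1; apply: eq_bigr => j _; congr (_ * _).
    by case: eqP => [->|]; rewrite ?mul1r ?mulr0.
  transitivity (\sum_j u j * (if j == n :> nat then n.+1%:R * ((-1) ^+ n * B) else 0)).
    by apply: eq_bigr => j _; congr (_ * _); case: eqP => [->|]; rewrite ?mulr0.
  by rewrite Sn; ring: sgn.
have G : \sum_j u j * (((s + 2^-1)%:P + 2 * 'X) * (if j == 0 :> nat then b else 0) +
     2 * 'X * ((if j == 0 :> nat then h (-1) else 0) + (if j == 1 :> nat then b else 0)) -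
     (j.+1)%:R * ((if j == n :> nat then (-1) ^+ n * B else 0) + (if j == 0 :> nat then b else 0))) =
   ((s + 2^-1)%:P + 2 * 'X) * (a * b) + 2 * 'X * (a * h (-1)) + 'X * (- a^`() * b)
   - (a * b + n.+1%:R * (c * B)).
  rewrite -F -S2 -!S1 !big_distrr /= -!big_split /= -sumrB.
  apply: eq_bigr => j _; move: (if _ then b else 0) (if _ == 1 then _ else _). move: (u j) (j.+1%:R : {poly C}) ((s + 2^-1)%:P) (if _ == 0 then _ else _) (if _ == n then _ else _). move=> *; ring.
rewrite G in E; move: E.
have -> : n.*2.+1%:R = 2 * n%:R + 1 :> {poly C} by rewrite -natr1 -mul2n natrM.
have -> : (s + 2^-1 + n%:R)%:P = (s + 2^-1)%:P + n%:R.
  by rewrite rmorphD /= -[n%:R in RHS](rmorph_nat (@polyC C)).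
rewrite -[n.+1%:R]natr1 => E'.
have V' : c * B = A * d - a * b by rewrite V; ring.
rewrite V' in E'; rewrite -D.
have -> : (2 * n%:R + 1) * (A * d) = A * (d * n%:R) + (n%:R + 1) * (A * d) by ring.
rewrite -E'; move: ((s + 2^-1)%:P) (n%:R : {poly C}) => mu m.
by ring.
Qed.

(** By Cramer's rule A times column -1 of [M] is the combination of its columns with coefficients
    [t j]. Pairing both sides with [cof] gives A(b + b'/2) on one side and aB + A'b/2 on the
    other. *)
Lemma Upos_lower : a * B * 2 = 2 * (A * b) + A * b^`() - A^`() * b.
Proof.
pose t j : {poly C} := \sum_i (\adj M) j i * pk (n%:Z - 2 * i%:Z) s.
have t0 : 2 * t 0 = A^`().
  rewrite /A UposE deriv_staircase; congr (_ * _); apply: eq_bigr => i _.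
  by rewrite mxE; congr (_ * pk _ _); lia.
(* The last column is replaced by column -1; moving that to the front gives the matrix with k = n,
   whose determinant is a. *)
have tn : t ord_max = (-1) ^+ n * a.
  rewrite /a -det_staircase_last (expand_det_col _ 0) big_distrr.
  apply: eq_bigr => i _ /=.
  rewrite !mxE /cofactor /M (_ : n.+1%:Z = n%:Z + 1); last by lia.
  by rewrite minor_shift /= addn0 addr0 exprD; ring.
have trel (i : 'I_n.+1) : \sum_(j < n.+1) pk (n.+1%:Z - 2 * i%:Z + j%:Z) s * t j = A * pk (n%:Z - 2 * i%:Z) s.
  pose v : 'cV[{poly C}]_n.+1 := \col_i pk (n%:Z - 2 * i%:Z) s.
  have /matrixP/(_ i 0) : M *m (\adj M *m v) = (\det M)%:M *m v.
    by rewrite mulmxA mul_mx_adj.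
  rewrite mul_scalar_mx mxE [RHS]mxE [v i 0]mxE => <-.
  apply: eq_bigr => j _; rewrite !mxE; congr (_ * _).
  by apply: eq_bigr => i' _; rewrite !mxE.
have L : \sum_i cof i * (\sum_(j < n.+1) pk (n.+1%:Z - 2 * i%:Z + j%:Z) s * t j)
       = A * (b + h (-1)).
  rewrite /b -(det_staircase_last n (s - 1)) -colfun0 /h /colfun -big_split big_distrr.
  apply: eq_bigr => i _ /=; rewrite trel pk_shift addr0.
  by rewrite -/(cof i); ring.
have R : \sum_i cof i * (\sum_(j < n.+1) pk (n.+1%:Z - 2 * i%:Z + j%:Z) s * t j)
       = t ord_max * ((-1) ^+ n * B) + t 0 * b.
  under eq_bigr do rewrite big_distrr /=.
  rewrite exchange_big /=.
  transitivity (\sum_j (t j * (if j == n :> nat then (-1) ^+ n * B else 0)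
               + t j * (if j == 0 :> nat then b else 0))).
    apply: eq_bigr => j _; rewrite -mulrDr -sum_cof_pk big_distrr.
    by apply: eq_bigr => i _ /=; ring.
  rewrite big_split /=; congr (_ + _).
    rewrite (bigD1 ord_max) //= eqxx big1 ?addr0 // => j.
    by rewrite -val_eqE /= => /negbTE ->; rewrite mulr0.
  by rewrite big_ord_recl /= big1 ?addr0 // => j _; rewrite mulr0.
move: L; rewrite R tn => E.
have -> : a * B = A * (b + h (-1)) - t 0 * b.
  by rewrite -E; have := sign_sq; move: ((-1) ^+ n) => e ee; ring: ee.
by rewrite -t0 -h_deriv; ring.
Qed.

(** This is [double_sum] for the first-column cofactors of B itself; by [pk_shift] only the columns
    j = 0 and j = 1 survive, and [sum_u_second] evaluates the latter. *)
Lemma Upos_raise : 2 * (A * b) = 2 * (a * B) + a * B^`() - a^`() * B.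
Proof.
pose cof2 (i : 'I_n.+1) := cofactor (staircase n.+1 n.+1%:Z (s - 1)) i 0.
pose g := colfun n n.+1%:Z (s - 1).
have c0 : cof2 0 = b.
  rewrite /cof2 /cofactor minor00 expr0 mul1r (_ : _ - 1 = n%:Z) //; lia.
have gd : 2 * g (-1) = B^`() by rewrite -deriv_staircase.
have E (j : 'I_n.+1) : \sum_i cof2 i * pk (n.+1%:Z - 2 * i%:Z + j%:Z) s =
  (if j == 0 :> nat then B + g (-1) else 0) + (if j == 1 :> nat then B else 0).
  transitivity (g j%:Z + g (j%:Z - 1)).
    rewrite -big_split; apply: eq_bigr => i _ /=.
    by rewrite pk_shift mulrDr; congr (_ * pk _ _ + _ * pk _ _); lia.
  case: j => -[|[|j]] jn /=; first by rewrite addr0 /g colfun0.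
    by rewrite subrr /g colfun0 colfun_mid.
  rewrite (_ : _ - 1 = j.+1%:Z); last by lia.
  by rewrite /g !colfun_mid ?addr0 //; lia.
have := double_sum cof2.
under eq_bigr do rewrite E mulrDr.
rewrite big_split /= sum_u_first c0 => F.
have := sum_u_second B; set S := \sum_j _ in F *.
move=> S2; rewrite -F -gd.
have -> : a^`() * B = - (2 * S) by rewrite S2; ring.
by ring.
Qed.

End Size.
End Bilinear.

(** * Derivation and limits at infinity in the field of fractions *)

Section FracDeriv.
Variable C : numClosedFieldType.
Local Notation K := {fraction {poly C}}.
Implicit Types (f g : K) (n d p : {poly C}) (c : C).

Lemma frac_reprE f : f = (\n_(repr f))%:F / (\d_(repr f))%:F.
Proof.
apply: (canRL (mulfK _)); first by rewrite tofrac_eq0 denom_ratioP.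
rewrite -[f in LHS](@reprK _ K); unlock FracField.tofrac.
rewrite -[LHS]FracField.pi_mul; apply/eqmodP => /=.
rewrite FracField.equivfE /FracField.mulf.
rewrite !numden_Ratio ?mulf_neq0 ?oner_neq0 ?denom_ratioP //.
by rewrite reprK !mulr1 mulrC.
Qed.

Lemma fracP f : exists n d, d != 0 /\ f = n%:F / d%:F.
Proof. by exists (\n_(repr f)), (\d_(repr f)); rewrite denom_ratioP -frac_reprE. Qed.

Lemma tofrac_neq0 p : p != 0 -> p%:F != 0.
Proof. by rewrite tofrac_eq0. Qed.

Lemma eq_frac n d n' d' : d != 0 -> d' != 0 ->
  (n%:F / d%:F == n'%:F / d'%:F) = (n * d' == n' * d).
Proof. by move=> h h'; rewrite eqr_div ?tofrac_eq0 // -!tofracM tofrac_eq. Qed.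

(** Independence of the representative: the cross-multiplied equality of two representatives and its
    derivative imply equality of the two quotient rules. *)
Lemma fderivE n d : d != 0 ->
  fderiv (n%:F / d%:F) = (n^`() * d - n * d^`())%:F / (d ^+ 2)%:F.
Proof.
move=> d0; rewrite /fderiv; set r := repr _.
have r0 : \d_r != 0 by rewrite denom_ratioP.
have : (\n_r)%:F / (\d_r)%:F == n%:F / d%:F by rewrite -frac_reprE.
rewrite eq_frac // => /eqP e; have := congr1 (@deriv C) e; rewrite !derivM => e'.
apply/eqP; rewrite eq_frac ?expf_neq0 //; apply/eqP.
move: e e' {r0}; move: (\n_r) (\d_r) => m k; move: (m^`()) (k^`()) (n^`()) (d^`()).
move=> m' k' n' d' e e'.
have -> : (m' * k - m * k') * d ^+ 2 = d * k * (m' * d + m * d') - d' * k * (m * d)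
   - d * k' * (m * d) by ring.
by rewrite e' e; ring.
Qed.

Local Opaque fderiv.

Lemma fderiv_tofrac p : fderiv p%:F = (p^`())%:F.
Proof.
rewrite -[p%:F]divr1 -tofrac1 fderivE ?oner_neq0 //.
by rewrite derivC mulr1 mulr0 subr0 expr1n tofrac1 divr1.
Qed.

Lemma fderiv_cF c : fderiv (cF c) = 0.
Proof. by rewrite fderiv_tofrac derivC tofrac0. Qed.

Lemma fderiv_xF : fderiv (xF C) = 1.
Proof. by rewrite fderiv_tofrac derivX tofrac1. Qed.

Lemma mul_frac (F : fieldType) (a b c d : F) : a / b * (c / d) = (a * c) / (b * d).
Proof. by rewrite invfM mulrACA. Qed.

Lemma fderivM f g : fderiv (f * g) = fderiv f * g + f * fderiv g.
Proof.
have [n [d [d0 ->]]] := fracP f; have [m [k [k0 ->]]] := fracP g.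
rewrite (mul_frac n%:F) -!tofracM (fderivE _ (mulf_neq0 d0 k0)).
rewrite (fderivE n d0) (fderivE m k0) !derivM.
rewrite !(tofracM, tofracB, tofracD, tofracN, tofracXn).
have := tofrac_neq0 d0; have := tofrac_neq0 k0.
move: (n%:F) (d%:F) (m%:F) (k%:F) (n^`())%:F (d^`())%:F (m^`())%:F (k^`())%:F.
(* Over an arbitrary field, with derivatives as free variables, only an identity of rational
   expressions remains. *)
suff H (F : fieldType) (a b c e a' b' c' e' : F) : e != 0 -> b != 0 ->
  ((a' * c + a * c') * (b * e) - a * c * (b' * e + b * e')) / (b * e) ^+ 2 =
  (a' * b - a * b') / b ^+ 2 * (c / e) + a / b * ((c' * e - c * e') / e ^+ 2).
  exact: (H K).
by move=> h h'; field; rewrite h h'.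
Qed.

Lemma fderivD f g : fderiv (f + g) = fderiv f + fderiv g.
Proof.
have [n [d [d0 ->]]] := fracP f; have [m [k [k0 ->]]] := fracP g.
rewrite addf_div ?tofrac_neq0 // -!tofracM -tofracD.
rewrite (fderivE _ (mulf_neq0 d0 k0)) (fderivE n d0) (fderivE m k0).
rewrite derivD !derivM !(tofracM, tofracB, tofracD, tofracN, tofracXn).
have := tofrac_neq0 d0; have := tofrac_neq0 k0.
move: (n%:F) (d%:F) (m%:F) (k%:F) (n^`())%:F (d^`())%:F (m^`())%:F (k^`())%:F.
suff H (F : fieldType) (a b c e a' b' c' e' : F) : e != 0 -> b != 0 ->
  ((a' * e + a * e' + (c' * b + c * b')) * (b * e)
     - (a * e + c * b) * (b' * e + b * e')) / (b * e) ^+ 2 =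
  (a' * b - a * b') / b ^+ 2 + (c' * e - c * e') / e ^+ 2.
  exact: (H K).
by move=> h h'; field; rewrite h h'.
Qed.

Lemma fderiv0 : fderiv (0 : K) = 0.
Proof. by rewrite -tofrac0 fderiv_tofrac deriv0. Qed.

Lemma fderiv1 : fderiv (1 : K) = 0.
Proof. by rewrite -tofrac1 fderiv_tofrac derivC tofrac0. Qed.

Lemma fderivN f : fderiv (- f) = - fderiv f.
Proof. by apply/eqP; rewrite -addr_eq0 -fderivD addNr fderiv0. Qed.

Lemma fderivB f g : fderiv (f - g) = fderiv f - fderiv g.
Proof. by rewrite fderivD fderivN. Qed.

Lemma fderivV f : fderiv f^-1 = - fderiv f / f ^+ 2.
Proof.
have [->|f0] := eqVneq f 0; first by rewrite invr0 fderiv0 oppr0 mul0r.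
have := fderivM f f^-1; rewrite divff // fderiv1 => /esym/eqP.
rewrite addrC addr_eq0 => /eqP e; apply: (mulfI f0); rewrite e.
move: f0; move: f (fderiv f) {e}.
suff H (F : fieldType) (a b : F) : a != 0 -> - (b / a) = a * (- b / a ^+ 2).
  exact: (H K).
by move=> h; field.
Qed.

Lemma fderiv_cFM c f : fderiv (cF c * f) = cF c * fderiv f.
Proof. by rewrite fderivM fderiv_cF mul0r add0r. Qed.

Lemma xF_neq0 : xF C != 0.
Proof. by rewrite tofrac_neq0 // polyX_eq0. Qed.

End FracDeriv.

(* Otherwise unification unfolds [fderiv] down to representatives of fractions. *)
Local Opaque fderiv.

(** * Limits at infinity of rational functions *)

Section Limits.
Variable C : numClosedFieldType.
Local Notation K := {fraction {poly C}}.
Implicit Types (f g : K) (n d p : {poly C}) (c : C).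

(** The limit c at infinity in terms of degrees: n/d - c = (n - cd)/d has a numerator of smaller
    degree. The strict inequality forces d != 0. *)
Definition flim f c := exists n d,
  f = n%:F / d%:F /\ (size (n - c *: d)%R < size d)%N.

Lemma size_gt_neq0 p d : (size p < size d)%N -> d != 0.
Proof. by rewrite -size_poly_gt0; apply: leq_ltn_trans. Qed.

Lemma size_mul_lt (p q a b : {poly C}) : (size p < size a)%N ->
  (size q <= size b)%N -> b != 0 -> (size (p * q)%R < size (a * b)%R)%N.
Proof.
move=> pa qb b0; have a0 := size_gt_neq0 pa.
have h : (0 < size (a * b)%R)%N by rewrite size_poly_gt0 mulf_neq0.
have [->|p0] := eqVneq p 0; first by rewrite mul0r size_poly0.
have [->|q0] := eqVneq q 0; first by rewrite mulr0 size_poly0.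
rewrite !size_mul //; move: q0 pa qb; rewrite -size_poly_gt0.
by move: (size p) (size q) (size a) (size b); lia.
Qed.

Lemma size_add_lt (p q a : {poly C}) : (size p < size a)%N ->
  (size q < size a)%N -> (size (p + q)%R < size a)%N.
Proof. by move=> h h'; apply: leq_ltn_trans (size_polyD _ _) _; rewrite gtn_max h. Qed.

Lemma size_flim_le n d c : (size (n - c *: d)%R < size d)%N -> (size n <= size d)%N.
Proof.
move=> h; rewrite -[n](subrK (c *: d)); apply: leq_trans (size_polyD _ _) _.
by rewrite geq_max (ltnW h) size_scale_leq.
Qed.

Lemma flim_cF c : flim (cF c) c.
Proof.
exists c%:P, 1; split; first by rewrite tofrac1 divr1.
by rewrite -mul_polyC mulr1 subrr size_poly0 size_poly1.
Qed.

Lemma flimD f g a b : flim f a -> flim g b -> flim (f + g) (a + b).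
Proof.
case=> n [d [-> h]] [m [k [-> h']]].
have d0 := size_gt_neq0 h; have k0 := size_gt_neq0 h'.
exists (n * k + m * d), (d * k); split.
  by rewrite addf_div ?tofrac_neq0 // -!tofracM -tofracD.
rewrite -!mul_polyC in h h' *.
rewrite polyCD (_ : _ - _ = (n - a%:P * d) * k + (m - b%:P * k) * d); last by ring.
by apply: size_add_lt; [|rewrite [d * k]mulrC]; apply: size_mul_lt.
Qed.

Lemma flimM f g a b : flim f a -> flim g b -> flim (f * g) (a * b).
Proof.
case=> n [d [-> h]] [m [k [-> h']]].
have d0 := size_gt_neq0 h; have k0 := size_gt_neq0 h'.
exists (n * m), (d * k); split; first by rewrite mul_frac -!tofracM.
have mk := size_flim_le h'.
have ad : (size (a%:P * d)%R <= size d)%N by rewrite mul_polyC size_scale_leq.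
rewrite -!mul_polyC in h h' *.
rewrite polyCM (_ : _ - _ = (n - a%:P * d) * m + (m - b%:P * k) * (a%:P * d)); last by ring.
by apply: size_add_lt; [|rewrite [d * k]mulrC]; apply: size_mul_lt.
Qed.

Lemma flimN f a : flim f a -> flim (- f) (- a).
Proof.
move=> h; have := flimM (flim_cF (-1)) h; rewrite mulN1r.
by rewrite /cF polyCN tofracN tofrac1 mulN1r.
Qed.

Lemma flimB f g a b : flim f a -> flim g b -> flim (f - g) (a - b).
Proof. by move=> h h'; apply: flimD => //; apply: flimN. Qed.

Lemma flim_rep n d c : d != 0 -> flim (n%:F / d%:F) c -> (size (n - c *: d)%R < size d)%N.
Proof.
move=> d0 [m [k [/eqP e h]]]; have k0 := size_gt_neq0 h.
rewrite eq_frac // in e; move/eqP: e => e.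
have E : (n - c *: d) * k = (m - c *: k) * d by rewrite -!mul_polyC !mulrBl e; ring.
move: E h; set X := n - _; set Y := m - _ => E h.
have [->|X0] := eqVneq X 0; first by rewrite size_poly0 size_poly_gt0.
have Y0 : Y != 0.
  by apply: contraNneq (mulf_neq0 X0 k0) => Y0; rewrite E Y0 mul0r.
have := congr1 (fun p : {poly C} => size p) E; rewrite /= !size_mul //.
move: X0 k0 d0 h; rewrite -!size_poly_gt0.
by move: (size X) (size Y) (size k) (size d); lia.
Qed.

Lemma flim_uniq f a b : flim f a -> flim f b -> a = b.
Proof.
case=> n [d [e h]] h'; have d0 := size_gt_neq0 h.
rewrite e in h'; have {}h' := flim_rep d0 h'.
apply/eqP; rewrite -subr_eq0; apply: contraT => ab.
have : (size ((a - b) *: d)%R < size d)%N; last by rewrite size_scale ?ltnn.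
rewrite (_ : _ *: d = (n - b *: d) - (n - a *: d)).
  by apply: size_add_lt; rewrite ?size_polyN.
by rewrite scalerBl; ring.
Qed.

Lemma flimV f a : a != 0 -> flim f a -> flim f^-1 a^-1.
Proof.
move=> a0 [n [d [-> h]]].
have sn : size n = size d.
  by rewrite -[n](subrK (a *: d)) addrC size_polyDl size_scale.
exists d, n; rewrite invf_div sn; split=> //.
rewrite (_ : d - _ = (- a^-1) *: (n - a *: d)) ?size_scale ?oppr_eq0 ?invr_eq0 //.
by rewrite scalerBr scalerA mulNr mulVf // scaleNr scaleN1r opprK addrC.
Qed.

Lemma flim_xV : flim (xF C)^-1 0.
Proof.
exists 1, 'X; rewrite tofrac1 mul1r; split=> //.
by rewrite scale0r subr0 size_poly1 size_polyX.
Qed.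

Lemma flim_xF c : ~ flim (xF C) c.
Proof.
move=> h; have := flimM h flim_xV; rewrite mulr0 divff ?xF_neq0 // -tofrac1 => h1.
have /eqP := flim_uniq h1 (flim_cF 1); by rewrite eq_sym oner_eq0.
Qed.

(** The operator x d/dx multiplies the leading monomial by its degree, so the leading terms
    cancel. *)
Lemma size_euler p : p != 0 -> (size ('X * p^`() - (size p).-1%:R *: p)%R < size p)%N.
Proof.
rewrite -size_poly_gt0 => p0; rewrite -[X in (_ < X)%N](prednK p0) ltnS.
apply/leq_sizeP => j hj; rewrite coefB coefXM coefZ coef_deriv.
case: j hj => [|j] hj /=; first by rewrite sub0r (_ : (size p).-1 = 0%N) ?mul0r ?oppr0 //; lia.
rewrite -[_ *+ j.+1]mulr_natl -mulrBl.
have [->|hj'] := eqVneq j.+1 (size p).-1; first by rewrite subrr mul0r.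
by rewrite nth_default ?mulr0 //; move: hj hj' p0; move: (size p) => N; lia.
Qed.

(** The limit is deg n - deg d. Its integrality is the source of the integer N in the
    classification. *)
Lemma flim_logderiv f : f != 0 -> exists k : int, flim (xF C * (fderiv f / f)) k%:~R.
Proof.
have [n [d [d0 ->]]] := fracP f => f0.
have n0 : n != 0 by apply: contraNneq f0 => ->; rewrite tofrac0 mul0r.
exists ((size n).-1%:Z - (size d).-1%:Z).
exists ('X * (n^`() * d - n * d^`())), (n * d); split.
  rewrite fderivE // !(tofracM, tofracB, tofracD, tofracN, tofracXn) -/(xF C).
  have := tofrac_neq0 d0; have := tofrac_neq0 n0.
  move: (n%:F) (d%:F) (n^`())%:F (d^`())%:F (xF C).
  suff H (F : fieldType) (a b a' b' x : F) : a != 0 -> b != 0 ->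
    x * ((a' * b - a * b') / b ^+ 2 / (a / b)) = x * (a' * b - a * b') / (a * b).
    exact: (H K).
  by move=> h h'; field; rewrite h h'.
have hn := size_euler n0; have hd := size_euler d0.
rewrite -!mul_polyC rmorphB /= -!pmulrn in hn hd *.
rewrite polyCB (_ : _ - _ = ('X * n^`() - ((size n).-1%:R)%:P * n) * d +
   - ('X * d^`() - ((size d).-1%:R)%:P * d) * n); last by ring.
apply: size_add_lt; first exact: size_mul_lt.
by rewrite [n * d]mulrC; apply: size_mul_lt; rewrite ?size_polyN.
Qed.

(** With g = f - c, which tends to 0, x g' = g (x g'/g) and the second factor has a finite limit. *)
Lemma flim_xderiv f c : flim f c -> flim (xF C * fderiv f) 0.
Proof.
move=> h; have {h} := flimB h (flim_cF c); rewrite subrr.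
have -> : fderiv f = fderiv (f - cF c) by rewrite fderivB fderiv_cF subr0.
move: (f - cF c) => g h; have [->|g0] := eqVneq g 0.
  by rewrite fderiv0 mulr0; apply: (flim_cF 0).
have [k hk] := flim_logderiv g0; have := flimM h hk; rewrite mul0r.
by rewrite mulrCA [g * _]mulrC divfK.
Qed.

Lemma flim_divx f c : flim f c -> flim (f / xF C) 0.
Proof. by move=> h; have := flimM h flim_xV; rewrite mulr0. Qed.

Lemma flim_deriv f c : flim f c -> flim (fderiv f) 0.
Proof. by move/flim_xderiv/flim_divx; rewrite mulrAC divff ?mul1r ?xF_neq0. Qed.

Lemma flim_dichotomy f : (exists c, flim f c) \/ flim f^-1 0.
Proof.
have [n [d [d0 ->]]] := fracP f; case: (leqP (size n) (size d)) => h; last first.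
  by right; rewrite invf_div; exists d, n; rewrite scale0r subr0.
(* The coefficient of n is read at the degree of d, so the limit is 0 when n has smaller degree. *)
left; exists (n`_(size d).-1 / lead_coef d), n, d; split=> //.
move: d0; rewrite -size_poly_gt0 => d0; rewrite -[X in (_ < X)%N](prednK d0) ltnS.
apply/leq_sizeP => j hj; rewrite coefB coefZ.
have [->|hj'] := eqVneq j (size d).-1.
  by rewrite divfK ?subrr // lead_coef_eq0 -size_poly_gt0.
have hd : (size d <= j)%N by move: hj hj' d0; move: (size d) => N; lia.
by rewrite (nth_default _ hd) (nth_default _ (leq_trans h hd)) mulr0 subr0.
Qed.

End Limits.

(** * Behaviour of rational solutions *)

Section Equation.
Variable C : numClosedFieldType.
Local Notation K := {fraction {poly C}}.
Local Notation x := (xF C).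
Implicit Types (u v w : K) (P Q : {poly C}) (c alpha beta : C).

Lemma cFM a b : cF (a * b) = cF a * cF b :> K.
Proof. by rewrite /cF polyCM tofracM. Qed.

Lemma cFN a : cF (- a) = - cF a :> K.
Proof. by rewrite /cF polyCN tofracN. Qed.

Lemma cF_nat n : cF n%:R = n%:R :> K.
Proof. by rewrite /cF -[n%:R]/(n%:R : C) !rmorph_nat. Qed.

Lemma flim_nat n : flim (n%:R : K) n%:R.
Proof. by rewrite -cF_nat; apply: flim_cF. Qed.

Lemma flim1 : flim (1 : K) 1.
Proof. exact: flim_nat 1. Qed.

(* Painleve III with gamma = 4 and delta = -4, multiplied by x / v. *)
Definition PIIIlog alpha beta v := v != 0 /\
  x * fderiv (fderiv v / v) + fderiv v / v
  = cF alpha * v + cF beta / v + 4 * x * (v ^+ 2 - v ^- 2).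

Lemma fderiv_log_frac v : v != 0 ->
  fderiv (fderiv v / v) = (fderiv (fderiv v) * v - fderiv v ^+ 2) / v ^+ 2.
Proof.
rewrite fderivM fderivV; move: v (fderiv v) (fderiv (fderiv v)).
suff H (F : fieldType) (v v' v'' : F) : v != 0 ->
  v'' / v + v' * (- v' / v ^+ 2) = (v'' * v - v' ^+ 2) / v ^+ 2.
  exact: (H K).
by move=> h; field.
Qed.

Lemma PIII_log alpha beta v : PIII alpha beta 4 (- 4) v <-> PIIIlog alpha beta v.
Proof.
suff H : v != 0 -> fderiv (fderiv v) =
    (fderiv v) ^+ 2 / v - fderiv v / x
    + (cF alpha * v ^+ 2 + cF beta) / x + cF 4 * v ^+ 3 + cF (- 4) / v <->
    x * fderiv (fderiv v / v) + fderiv v / v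
    = cF alpha * v + cF beta / v + 4 * x * (v ^+ 2 - v ^- 2).
  by split=> -[v0 e]; split=> //; apply/H.
move=> v0; rewrite fderiv_log_frac // cFN (cF_nat 4); move: v0 (xF_neq0 C).
move: x v (fderiv v) (fderiv (fderiv v)) (cF alpha) (cF beta).
suff H (F : fieldType) (x v v' v'' a b : F) : v != 0 -> x != 0 ->
  v'' = v' ^+ 2 / v - v' / x + (a * v ^+ 2 + b) / x + 4 * v ^+ 3 + (- 4) / v <->
  x * ((v'' * v - v' ^+ 2) / v ^+ 2) + v' / v = a * v + b / v + 4 * x * (v ^+ 2 - v ^- 2).
  exact: (H K).
move=> v0 x0; split=> [->|e]; first by field; rewrite v0 x0.
have -> : v'' = (x * ((v'' * v - v' ^+ 2) / v ^+ 2) + v' / v) * v / x + v' ^+ 2 / v - v' / x.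
  by field; rewrite v0 x0.
by rewrite e; field; rewrite v0 x0.
Qed.

Lemma fderiv_logV v : v != 0 -> fderiv v^-1 / v^-1 = - (fderiv v / v).
Proof.
rewrite fderivV; move: v (fderiv v).
suff H (F : fieldType) (v a : F) : v != 0 -> - a / v ^+ 2 / v^-1 = - (a / v).
  exact: (H K).
by move=> h; rewrite invrK; field.
Qed.

(** Inversion negates the logarithmic derivative and exchanges v with 1/v on the right. *)
Lemma PIIIlogV alpha beta v : PIIIlog alpha beta v -> PIIIlog (- beta) (- alpha) v^-1.
Proof.
case=> v0 e; split; first by rewrite invr_eq0.
rewrite fderiv_logV // fderivN mulrN -opprD e !cFN invrK exprVn invrK.
by ring.
Qed.

Lemma PIIIlogN alpha beta v : PIIIlog alpha beta v -> PIIIlog (- alpha) (- beta) (- v).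
Proof.
case=> v0 e; split; first by rewrite oppr_eq0.
by rewrite fderivN invrN mulrNN e !cFN !mulrNN sqrrN.
Qed.

(** The left side of the equation is the derivative of x v'/v, which tends to an integer; hence x
    times it tends to 0. *)
Lemma PIIIlog_flim alpha beta v : PIIIlog alpha beta v ->
  flim (x * (cF alpha * v + cF beta / v + 4 * x * (v ^+ 2 - v ^- 2))) 0.
Proof.
case=> v0 <-; have [k /flim_xderiv] := flim_logderiv v0.
by rewrite fderivM fderiv_xF mul1r addrC.
Qed.

Lemma flim_exp v c n : flim v c -> flim (v ^+ n) (c ^+ n).
Proof.
by move=> h; elim: n => [|n IH]; [exact: flim1 | rewrite !exprS; apply: flimM].
Qed.

(** If 1/v tended to 0, the expression of [PIIIlog_flim] divided by (xv)^2 would tend to 0, but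
    computed termwise it tends to 4. *)
Lemma PIIIlog_bounded alpha beta v : PIIIlog alpha beta v -> ~ flim v^-1 0.
Proof.
move=> h hv; have := PIIIlog_flim h; have v0 := proj1 h; have x0 := xF_neq0 C.
move=> /(fun h => flimM h (flim_exp 2 (flimM (flim_xV C) hv))).
rewrite mul0r => h0.
have h4 : flim (cF alpha * v^-1 / x + cF beta * v^-1 ^+ 3 / x + 4 * (1 - v^-1 ^+ 4)) (4 * (1 - 0 ^+ 4)).
  rewrite -[X in flim _ X]add0r; apply: flimD.
    rewrite -[X in flim _ X]add0r; apply: flimD; apply: flim_divx.
      exact: flimM (flim_cF _) hv.
    exact: flimM (flim_cF _) (flim_exp 3 hv).
  by apply: flimM (flim_nat 4) (flimB flim1 (flim_exp 4 hv)).
suff e : x * (cF alpha * v + cF beta / v + 4 * x * (v ^+ 2 - v ^- 2)) * (x^-1 * v^-1) ^+ 2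
  = cF alpha * v^-1 / x + cF beta * v^-1 ^+ 3 / x + 4 * (1 - v^-1 ^+ 4).
  rewrite e in h0; have /eqP := flim_uniq h0 h4.
  by rewrite expr0n subr0 mulr1 eq_sym pnatr_eq0.
move: v0 x0; clear; move: x v (cF alpha) (cF beta).
suff H (F : fieldType) (x v a b : F) : v != 0 -> x != 0 ->
  x * (a * v + b / v + 4 * x * (v ^+ 2 - v ^- 2)) * (x^-1 * v^-1) ^+ 2
  = a * v^-1 / x + b * v^-1 ^+ 3 / x + 4 * (1 - v^-1 ^+ 4).
  exact: (H K).
by move=> h h'; field; rewrite h h'.
Qed.

(** [PIIIlog_bounded] for v and for 1/v makes c finite and nonzero. Dividing the expression of
    [PIIIlog_flim] by x^2 then gives 4(c^2 - c^-2) = 0. *)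
Lemma PIIIlog_limit alpha beta v : PIIIlog alpha beta v ->
  exists c, c ^+ 4 = 1 /\ flim v c.
Proof.
move=> h; have [[c hc]|/(PIIIlog_bounded h)//] := flim_dichotomy v.
have c0 : c != 0.
  apply/eqP => c0; have := PIIIlog_bounded (PIIIlogV h).
  by rewrite invrK -c0.
exists c; split=> //; have hV := flimV c0 hc.
have := PIIIlog_flim h; have v0 := proj1 h; have x0 := xF_neq0 C.
move=> /flim_divx/flim_divx h0.
have h4 : flim ((cF alpha * v + cF beta * v^-1) / x + 4 * (v ^+ 2 - v^-1 ^+ 2))
               (4 * (c ^+ 2 - c^-1 ^+ 2)).
  rewrite -[X in flim _ X]add0r; apply: flimD.
    by apply: flim_divx; apply: flimD; apply: flimM (flim_cF _) _; eassumption.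
  by apply: flimM (flim_nat 4) (flimB (flim_exp 2 hc) (flim_exp 2 hV)).
suff e : x * (cF alpha * v + cF beta / v + 4 * x * (v ^+ 2 - v ^- 2)) / x / x
  = (cF alpha * v + cF beta * v^-1) / x + 4 * (v ^+ 2 - v^-1 ^+ 2).
  rewrite e in h0; have /esym/eqP := flim_uniq h0 h4.
  rewrite mulf_eq0 pnatr_eq0 /= subr_eq0 exprVn => /eqP e4.
  by rewrite (exprM c 2 2) expr2 {1}e4 mulVf // expf_neq0.
move: v0 x0; clear; move: x v (cF alpha) (cF beta).
suff H (F : fieldType) (x v a b : F) : v != 0 -> x != 0 ->
  x * (a * v + b / v + 4 * x * (v ^+ 2 - v ^- 2)) / x / x
  = (a * v + b * v^-1) / x + 4 * (v ^+ 2 - v^-1 ^+ 2).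
  exact: (H K).
by move=> h h'; field; rewrite h h'.
Qed.

(** As c^4 = 1, v^2 - v^-2 = (v^4 - c^4)/v^2 contains the factor v - c. In the limit alpha c +
    beta/c + 8kc = 0. *)
Lemma PIIIlog_coef alpha beta v c k : PIIIlog alpha beta v -> c ^+ 4 = 1 ->
  flim v c -> flim (2 * x * (v - cF c)) k -> alpha + beta * c ^+ 2 = - 8 * k.
Proof.
move=> h c4 hc hk.
have c0 : c != 0 by apply/eqP => c0; move/eqP: c4; rewrite c0 expr0n eq_sym oner_eq0.
have := PIIIlog_flim h; have v0 := proj1 h; have x0 := xF_neq0 C.
have hV := flimV c0 hc; have fc := flim_cF c.
move=> /flim_divx h0.
have h4 : flim (cF alpha * v + cF beta * v^-1 + 2 * (2 * x * (v - cF c)) *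
     ((v ^+ 3 + v ^+ 2 * cF c + v * (cF c) ^+ 2 + (cF c) ^+ 3) * v^-1 ^+ 2))
   (alpha * c + beta * c^-1 + 2 * k * ((c ^+ 3 + c ^+ 2 * c + c * c ^+ 2 + c ^+ 3) * c^-1 ^+ 2)).
  by repeat first [exact: hk | exact: hc | exact: fc | exact: hV | exact: flim_cF
     | exact: (flim_nat 2) | apply: flim_exp | apply: flimD | apply: flimM].
have cc4 : (cF c) ^+ 4 = 1 :> K by rewrite /cF -tofracXn -rmorphXn /= c4 tofrac1.
suff e : x * (cF alpha * v + cF beta / v + 4 * x * (v ^+ 2 - v ^- 2)) / x
  = cF alpha * v + cF beta * v^-1 + 2 * (2 * x * (v - cF c)) *
     ((v ^+ 3 + v ^+ 2 * cF c + v * (cF c) ^+ 2 + (cF c) ^+ 3) * v^-1 ^+ 2).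
  rewrite e in h0; have := flim_uniq h0 h4.
  have -> : alpha * c + beta * c^-1 +
    2 * k * ((c ^+ 3 + c ^+ 2 * c + c * c ^+ 2 + c ^+ 3) * c^-1 ^+ 2)
    = c * (alpha + beta * (c ^+ 4)^-1 * c ^+ 2 + 8 * k) by field.
  rewrite c4 invr1 mulr1 => /esym/eqP; rewrite mulf_eq0 (negbTE c0) /= addr_eq0.
  by move/eqP => ->; rewrite mulNr.
move: v0 x0 cc4; clear; move: x v (cF alpha) (cF beta) (cF c); clear.
suff H (F : fieldType) (x v a b c : F) : v != 0 -> x != 0 -> c ^+ 4 = 1 ->
  x * (a * v + b / v + 4 * x * (v ^+ 2 - v ^- 2)) / x
  = a * v + b * v^-1 + 2 * (2 * x * (v - c)) *
     ((v ^+ 3 + v ^+ 2 * c + v * c ^+ 2 + c ^+ 3) * v^-1 ^+ 2).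
  exact: (H K).
move=> h1 h2 h3.
have -> : v ^+ 2 - v ^- 2 = (v ^+ 4 - c ^+ 4) / v ^+ 2 by rewrite h3; field.
by field; rewrite h1 h2.
Qed.

(** Put w = v(1 + eta). If eta != 0, subtract the two equations and divide by eta x: the left side
    tends to 0, the right side to 8 c^2 (1 + c^-4) = 16 c^2. *)
Lemma PIIIlog_unique alpha beta c v w : c ^+ 4 = 1 ->
  PIIIlog alpha beta v -> PIIIlog alpha beta w -> flim v c -> flim w c -> v = w.
Proof.
move=> c4 [v0 ev] [w0 ew] hv hw; have x0 := xF_neq0 C.
have c0 : c != 0 by apply/eqP => c0; move/eqP: c4; rewrite c0 expr0n eq_sym oner_eq0.
have hVv := flimV c0 hv; have hVw := flimV c0 hw.
have [eta [we he]] : exists eta, w = v * (1 + eta) /\ flim eta 0.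
  exists (w / v - 1); rewrite addrC subrK mulrC (divfK v0); split; first exact: erefl.
  by rewrite -(subrr 1) -{1}(divff c0); apply: flimB flim1; apply: flimM.
have [e0|e0] := eqVneq eta 0; first by rewrite we e0 addr0 mulr1.
exfalso.
have n0 : 1 + eta != 0 by apply: contraNneq w0 => e; rewrite we e mulr0.
have [k hk] := flim_logderiv e0.
(* Chosen so that w'/w - v'/v = eta q / x while q itself has a finite limit. *)
pose q := x * (fderiv eta / eta) / (1 + eta).
have hq : flim q k%:~R.
  rewrite -[k%:~R]divr1 -{2}[1](addr0 1); apply: flimM => //.
  by apply: flimV; [rewrite addr0 oner_eq0 | apply: flimD => //; exact: flim1].
have lw : fderiv w / w = fderiv v / v + eta * q / x.
  rewrite we fderivM fderivD fderiv1 add0r /q; move: v0 n0 e0 x0; clear.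
  move: x v (fderiv v) eta (fderiv eta).
  suff H (F : fieldType) (x v v' e e' : F) : v != 0 -> 1 + e != 0 -> e != 0 -> x != 0 ->
    (v' * (1 + e) + v * e') / (v * (1 + e)) = v' / v + e * (x * (e' / e) / (1 + e)) / x.
    exact: (H K).
  by move=> h1 h2 h3 h4; field; rewrite h1 h2 h3 h4.
clearbody q.
(* For f = eta q / x the expression x f' + f is the derivative of x f = eta q. *)
have dl : x * fderiv (eta * q / x) + eta * q / x = fderiv eta * q + eta * fderiv q.
  rewrite !fderivM fderivV fderiv_xF; move: x0; clear.
  move: eta (fderiv eta) q (fderiv q) x.
  suff H (F : fieldType) (e e' q q' x : F) : x != 0 ->
    x * ((e' * q + e * q') / x + e * q * (- 1 / x ^+ 2)) + e * q / x = e' * q + e * q'.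
    exact: (H K).
  by move=> h; field.
have h0 : flim ((fderiv eta * q + eta * fderiv q) / eta / x) 0.
  apply: (@flim_divx _ _ 0); rewrite (_ : _ / eta = (x * (fderiv eta / eta) * q) / x + fderiv q).
    rewrite -[X in flim _ X]addr0; apply: flimD; last exact: flim_deriv hq.
    by apply: flim_divx; apply: flimM; eassumption.
  move: x0 e0; clear; move: eta (fderiv eta) q (fderiv q) x.
  suff H (F : fieldType) (e e' q q' x : F) : x != 0 -> e != 0 ->
    (e' * q + e * q') / e = (x * (e' / e) * q) / x + q'.
  exact: (H K).
  by move=> h h'; field; rewrite h h'.
have h1 : flim ((cF alpha * v - cF beta * w^-1) / x +
    4 * (v * (w + v)) * (1 + w^-1 ^+ 2 * v^-1 ^+ 2))
   (0 + 4 * (c * (c + c)) * (1 + c^-1 ^+ 2 * c^-1 ^+ 2)).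
  apply: flimD.
    by apply: flim_divx; apply: flimB; apply: flimM (flim_cF _) _; eassumption.
  apply: flimM; last by apply: flimD; [exact: flim1 | apply: flimM; exact: flim_exp].
  by apply: flimM; [exact: (flim_nat 4) | apply: flimM => //; apply: flimD].
suff e : (fderiv eta * q + eta * fderiv q) / eta / x = (cF alpha * v - cF beta * w^-1) / x +
    4 * (v * (w + v)) * (1 + w^-1 ^+ 2 * v^-1 ^+ 2).
  rewrite e in h0; have /esym/eqP := flim_uniq h0 h1; apply/negP.
  have -> : 0 + 4 * (c * (c + c)) * (1 + c^-1 ^+ 2 * c^-1 ^+ 2) =
    8 * c ^+ 2 * (1 + (c ^+ 4)^-1) by field.
  by rewrite c4 invr1 !mulf_neq0 ?expf_neq0 ?pnatr_eq0 // -(natrD _ 1 1) pnatr_eq0.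
move: ew; rewrite lw fderivD mulrDr addrACA ev dl => ew.
have -> : fderiv eta * q + eta * fderiv q =
  (cF alpha * w + cF beta / w + 4 * x * (w ^+ 2 - w ^- 2)) -
  (cF alpha * v + cF beta / v + 4 * x * (v ^+ 2 - v ^- 2)).
  by rewrite -ew addrAC subrr add0r.
rewrite we in w0 *; move: v0 n0 e0 x0; clear.
move: v eta x (cF alpha) (cF beta).
suff H (F : fieldType) (v e x a b : F) : v != 0 -> 1 + e != 0 -> e != 0 -> x != 0 ->
  (a * (v * (1 + e)) + b / (v * (1 + e))
    + 4 * x * ((v * (1 + e)) ^+ 2 - (v * (1 + e)) ^- 2)
   - (a * v + b / v + 4 * x * (v ^+ 2 - v ^- 2))) / e / x =
  (a * v - b * (v * (1 + e))^-1) / x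
  + 4 * (v * (v * (1 + e) + v)) * (1 + (v * (1 + e))^-1 ^+ 2 * v^-1 ^+ 2).
  exact: (H K).
by move=> h1 h2 h3 h4; field; rewrite h1 h2 h3 h4.
Qed.

End Equation.

(** * Residues of solutions at nonzero poles *)

Section Residues.
Variable C : numClosedFieldType.
Local Notation K := {fraction {poly C}}.
Local Notation x := (xF C).
Implicit Types (u v w : K) (P Q : {poly C}) (c alpha beta : C).

Lemma log_fderiv_frac P Q : P != 0 -> Q != 0 ->
  fderiv (P%:F / Q%:F) / (P%:F / Q%:F) = (P^`() * Q - P * Q^`())%:F / (P * Q)%:F.
Proof.
move=> P0 Q0; rewrite fderivE // tofracXn tofracM.
have := tofrac_neq0 P0; have := tofrac_neq0 Q0.
move: (P%:F) (Q%:F) (P^`() * Q - P * Q^`())%:F.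
suff H (F : fieldType) (p q w : F) : q != 0 -> p != 0 ->
  w / q ^+ 2 / (p / q) = w / (p * q).
  exact: (H K).
by move=> h h'; field; rewrite h h'.
Qed.

Lemma PIIIlog_poly alpha beta P Q : Q != 0 -> PIIIlog alpha beta (P%:F / Q%:F) ->
  let W := P^`() * Q - P * Q^`() in
  'X * (W^`() * (P * Q) - W * (P * Q)^`()) + P * Q * W =
  alpha%:P * P ^+ 3 * Q + beta%:P * P * Q ^+ 3 + 4 * 'X * (P ^+ 4 - Q ^+ 4).
Proof.
move=> Q0 [v0 e] W.
have P0 : P != 0 by apply: contraNneq v0 => ->; rewrite tofrac0 mul0r.
move: e; rewrite log_fderiv_frac // -/W fderivE ?mulf_neq0 //.
move=> e; apply/eqP; rewrite -tofrac_eq; apply/eqP.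
(* The numeral 4 is hidden behind a variable while the embedding is distributed over sums and
   products. *)
move: e; set Z := _ - W * _; have [q4 e4] : {q4 : {poly C} | q4 = 4} by exists 4.
clearbody Z; clearbody W; rewrite -[X in X * 'X]e4 -/(cF alpha) -/(cF beta).
rewrite !(tofracM, tofracB, tofracD, tofracN, tofracXn) -/(cF alpha) -/(cF beta) -/(xF C).
rewrite e4 rmorph_nat => e.
move: e; have := tofrac_neq0 P0; have := tofrac_neq0 Q0.
move: (P%:F) (Q%:F) (W%:F) (Z%:F) x (cF alpha) (cF beta).
suff H (F : fieldType) (p q w z x a b : F) : q != 0 -> p != 0 ->
   x * (z / (p * q * (p * q))) + w / (p * q) =
   a * (p / q) + b / (p / q) + 4 * x * ((p / q) ^+ 2 - (p / q) ^- 2) ->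
   x * z + p * q * w = a * (p * (p * p)) * q + b * p * (q * (q * q))
     + 4 * x * (p * (p * (p * p)) - q * (q * (q * q))).
  exact: (H K).
move=> q0 p0 e.
transitivity ((x * (z / (p * q * (p * q))) + w / (p * q)) * (p * q) ^+ 2).
  by field; rewrite p0 q0.
by rewrite e; field; rewrite p0 q0.
Qed.

(** At a root r of Q the cleared equation becomes r P(r)^2 (Q'(r)^2 - 4 P(r)^2) = 0. So the pole is
    simple with residue P(r)/Q'(r) = 1/2 or -1/2. *)
Lemma PIIIlog_residue alpha beta P Q (r : C) : coprimep P Q -> Q != 0 ->
  PIIIlog alpha beta (P%:F / Q%:F) -> root Q r -> r != 0 ->
  Q^`().[r] != 0 /\ (Q^`().[r] = 2 * P.[r] \/ Q^`().[r] = - (2 * P.[r])).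
Proof.
move=> co Q0 /(PIIIlog_poly Q0) /= /(congr1 (fun p => p.[r])) e /rootP Qr r0.
have Pr : P.[r] != 0 by apply: (@coprimep_root _ Q); [rewrite coprimep_sym | apply/rootP].
have {}e : r * P.[r] ^+ 2 * ((Q^`().[r] - 2 * P.[r]) * (Q^`().[r] + 2 * P.[r])) = 0.
  move: e; rewrite !(derivM, derivB, hornerD, hornerN, hornerM, horner_exp, hornerX,
    hornerC, hornerMn) Qr => /eqP; rewrite -subr_eq0 => /eqP <-.
  by move: (P.[r]) (Q^`().[r]) (P^`().[r]) => p q p'; ring.
have p2 : 2 * P.[r] != 0 by rewrite mulf_neq0 ?pnatr_eq0.
move/eqP: e; rewrite !mulf_eq0 (negbTE r0) (negbTE Pr) /= subr_eq0 addr_eq0.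
by case/orP => /eqP ->; rewrite ?oppr_eq0; split=> //; [left | right].
Qed.

Lemma PIIIlog_integer_residues alpha beta P Q c : coprimep P Q -> Q.[0] != 0 ->
  PIIIlog alpha beta (P%:F / Q%:F) -> flim (P%:F / Q%:F) c ->
  exists k : int, flim (2 * x * (P%:F / Q%:F - cF c)) k%:~R.
Proof.
move=> co Q00 h hc.
have Q0 : Q != 0 by apply: contraNneq Q00 => ->; rewrite horner0.
have [rs eQ] := closed_field_poly_normal Q.
have k0 : lead_coef Q != 0 by rewrite lead_coef_eq0.
have rsP r : (r \in rs) = root Q r by rewrite eQ rootZ // root_prod_XsubC.
have res r : root Q r -> Q^`().[r] != 0 /\
    (Q^`().[r] = 2 * P.[r] \/ Q^`().[r] = - (2 * P.[r])).
  move=> Qr; apply: (PIIIlog_residue co Q0 h Qr).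
  by apply: contraTneq Qr => ->.
have urs : uniq rs.
  rewrite -separable_prod_XsubC -(eqp_separable (eqp_scale _ k0)) -eQ separable_poly.unlock.
  by apply/Pdiv.ClosedField.coprimepP => r /res[].
(* [S1] collects the poles of residue 1/2, [S2] those of residue -1/2; 2(v - c) will be the
   logarithmic derivative of S1/S2. *)
pose S1 := \prod_(z <- rs | Q^`().[z] == 2 * P.[z]) ('X - z%:P).
pose S2 := \prod_(z <- rs | Q^`().[z] != 2 * P.[z]) ('X - z%:P).
have eS : Q = lead_coef Q *: (S1 * S2).
  by rewrite {1}eQ (bigID (fun z => Q^`().[z] == 2 * P.[z])).
have SS0 : S1 * S2 != 0 by apply: contraNneq Q0 => e; rewrite eS e scaler0.
have [S10 S20] : S1 != 0 /\ S2 != 0 by move: SS0; rewrite mulf_eq0 => /norP.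
pose T := S1^`() * S2 - S1 * S2^`().
have eT : 2 *: (P - c *: Q) = lead_coef Q *: T.
  apply/eqP; rewrite -subr_eq0; apply/eqP.
  (* Partial fractions: both sides have size below that of Q and agree at its distinct roots. *)
  apply: (@roots_geq_poly_eq0 _ _ rs) => //.
    apply/allP => r; rewrite rsP => Qr; apply/rootP; have [_ hr] := res _ Qr.
    have Q'r : Q^`().[r] = lead_coef Q * (S1^`().[r] * S2.[r] + S1.[r] * S2^`().[r]).
      by rewrite {1}eS derivZ derivM !hornerE.
    rewrite /T !hornerE (rootP Qr) mulr0 subr0.
    have [S1r|S2r] : S1.[r] = 0 /\ Q^`().[r] = 2 * P.[r] \/
                     S2.[r] = 0 /\ Q^`().[r] = - (2 * P.[r]).
      have [er|er] := eqVneq (Q^`().[r]) (2 * P.[r]).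
        left; split=> //; apply/rootP; rewrite /S1 (big_rem r) ?rsP //= er eqxx.
        by rewrite rootM root_XsubC eqxx.
      right; split; last by case: hr => // e; rewrite e eqxx in er.
      apply/rootP; rewrite /S2 (big_rem r) ?rsP //= er.
      by rewrite rootM root_XsubC eqxx.
    - by case: S1r => z <-; rewrite Q'r z; ring.
    case: S2r => z q'; have <- : - Q^`().[r] = 2 * P.[r] by rewrite q' opprK.
    by rewrite Q'r z; ring.
  suff : (size (2 *: (P - c *: Q) - lead_coef Q *: T)%R < size Q)%N.
    have -> : size Q = (size rs).+1 by rewrite {1}eQ size_scale // size_prod_XsubC.
    by rewrite ltnS.
  apply: size_add_lt; first by rewrite size_scale ?pnatr_eq0 //; apply: flim_rep.
  rewrite size_polyN size_scale // eS size_scale //.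
  apply: size_add_lt; rewrite ?size_polyN; last rewrite mulrC [S1 * S2]mulrC;
    by apply: size_mul_lt; rewrite ?lt_size_deriv.
have f0 : S1%:F / S2%:F != 0 by rewrite mulf_neq0 ?invr_eq0 ?tofrac_neq0.
have [k hk] := flim_logderiv f0; exists k.
rewrite (_ : 2 * x * _ = x * (fderiv (S1%:F / S2%:F) / (S1%:F / S2%:F))) //.
rewrite log_fderiv_frac // -/T.
have e1 : 2 * (P - c%:P * Q) = (lead_coef Q)%:P * T.
  by rewrite !mul_polyC -eT scaler_nat mulr_natl.
have e2 : Q = (lead_coef Q)%:P * (S1 * S2) by rewrite mul_polyC.
move: e1 => /(congr1 (@FracField.tofrac _)); move: e2 => /(congr1 (@FracField.tofrac _)).
clearbody T; clearbody S1 S2; clear eT.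
rewrite !(tofracM, tofracB) -/(cF c) -/(cF (lead_coef Q)) rmorph_nat.
have := tofrac_neq0 S10; have := tofrac_neq0 S20; have := tofrac_neq0 Q0; clear.
move: (P%:F) (Q%:F) (S1%:F) (S2%:F) (T%:F) x (cF c) (cF (lead_coef Q)); clear.
suff H (F : fieldType) (p q s1 s2 t x c k : F) : q != 0 -> s2 != 0 -> s1 != 0 ->
  q = k * (s1 * s2) -> 2 * (p - c * q) = k * t -> 2 * x * (p / q - c) = x * (t / (s1 * s2)).
  exact: (H K).
move=> q0 s20 s10 eq ek.
have k0 : k != 0 by apply: contraNneq q0 => k0; rewrite eq k0 mul0r.
have -> : t = 2 * (p - c * q) / k by rewrite ek mulrAC divff ?mul1r.
by rewrite eq; field; rewrite k0 s10 s20.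
Qed.

End Residues.

(** * Existence *)

Section Existence.
Variable C : numClosedFieldType.
Local Notation K := {fraction {poly C}}.
Local Notation x := (xF C).
Local Notation L f := (fderiv f / f).
Implicit Types (s e : C) (n : nat) (p : {poly C}).

Lemma cFD a b : cF (a + b) = cF a + cF b :> K.
Proof. by rewrite /cF polyCD tofracD. Qed.

Lemma cF1 : cF 1 = 1 :> K.
Proof. exact: (cF_nat C 1). Qed.

(** The substitution x -> ex treats both kinds of families at once: e = 1 gives [UF], e = 'i^-1
    gives [UFi]. *)
Definition scaled e p : K := (p \Po (e *: 'X))%:F.

Lemma scaledM e p q : scaled e (p * q) = scaled e p * scaled e q.
Proof. by rewrite /scaled comp_polyM tofracM. Qed.

Lemma scaledD e p q : scaled e (p + q) = scaled e p + scaled e q.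
Proof. by rewrite /scaled comp_polyD tofracD. Qed.

Lemma scaledN e p : scaled e (- p) = - scaled e p.
Proof. by rewrite /scaled raddfN tofracN. Qed.

Lemma scaledC e c : scaled e c%:P = cF c.
Proof. by rewrite /scaled comp_polyC. Qed.

Lemma scaled_nat e n : scaled e n%:R = n%:R.
Proof. by rewrite -[n%:R](rmorph_nat (@polyC C)) scaledC cF_nat. Qed.

Lemma scaledX e : scaled e 'X = cF e * x.
Proof. by rewrite /scaled comp_polyX -mul_polyC tofracM. Qed.

Lemma fderiv_scaled e p : fderiv (scaled e p) = cF e * scaled e p^`().
Proof.
rewrite /scaled fderiv_tofrac deriv_comp derivZ derivX tofracM mulrC.
by rewrite -mul_polyC mulr1.
Qed.

Definition scaledE := (scaledM, scaledD, scaledN, scaledC, scaled_nat, scaledX).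

Lemma K_nat_neq0 n : n.+1%:R != 0 :> K.
Proof. by rewrite -cF_nat tofrac_eq0 polyC_eq0 pnatr_eq0. Qed.

Lemma fderiv_logM (f g : K) : f != 0 -> g != 0 -> L (f * g) = L f + L g.
Proof.
rewrite fderivM; move: f g (fderiv f) (fderiv g).
suff H (F : fieldType) (f g f' g' : F) : f != 0 -> g != 0 ->
  (f' * g + f * g') / (f * g) = f' / f + g' / g.
  exact: (H K).
by move=> h h'; field; rewrite h h'.
Qed.

Lemma fderiv_log_ratio (a b c d : K) : a != 0 -> b != 0 -> c != 0 -> d != 0 ->
  L (a * b / (c * d)) = L a + L b - (L c + L d).
Proof.
rewrite fderivM fderivV (fderivM a) (fderivM c).
move: a b c d (fderiv a) (fderiv b) (fderiv c) (fderiv d).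
suff H (F : fieldType) (a b c d a' b' c' d' : F) :
  a != 0 -> b != 0 -> c != 0 -> d != 0 ->
  ((a' * b + a * b') / (c * d) + a * b * (- (c' * d + c * d') / (c * d) ^+ 2))
  / (a * b / (c * d)) = a' / a + b' / b - (c' / c + d' / d).
  exact: (H K).
by move=> h1 h2 h3 h4; field; rewrite h1 h2 h3 h4.
Qed.

Definition tau e n s := scaled e (Upos n s).

(** * Rescaled determinants and the differential equation of their ratio *)

Section Scale.
Variable eps : C.
Hypothesis eps0 : eps != 0.
Local Notation T := (tau eps).
Local Notation E := (cF eps).

Lemma scaled_deriv p : scaled eps p^`() = fderiv (scaled eps p) / E.
Proof. by rewrite fderiv_scaled mulrC mulKf // tofrac_eq0 polyC_eq0. Qed.

Lemma cF_eps_neq0 : E != 0.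
Proof. by rewrite tofrac_eq0 polyC_eq0. Qed.

Lemma tau_euler n s : (n.*2.+1)%:R * (T n.+1 s * T n.-1 (s - 1)) =
  (cF (s + 2^-1 + n%:R) + 2 * (E * x)) * (T n s * T n (s - 1))
  + x * (T n s * fderiv (T n (s - 1)) - fderiv (T n s) * T n (s - 1)).
Proof.
have := congr1 (scaled eps) (Upos_euler n s).
rewrite !scaledE !scaled_deriv -!/(tau eps _ _) => ->; congr (_ + _).
have := cF_eps_neq0; move: E x (T n s) (T n (s - 1)) (fderiv (T n s)) (fderiv (T n (s - 1))).
suff H (F : fieldType) (e x a b a' b' : F) : e != 0 ->
  e * x * (a * (b' / e) - a' / e * b) = x * (a * b' - a' * b).
  exact: (H K).
by move=> h; field.
Qed.

Lemma tau_neq0 n s : T n s != 0.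
Proof.
suff: (forall s, T n s != 0) /\ (forall s, T n.-1 s != 0) by case.
elim: n => [|n [IH1 IH2]].
  by split=> t; rewrite /tau /Upos det_mx00 -[1]/(1%:R) scaled_nat oner_eq0.
split=> [t|]; last exact: IH1.
apply/eqP => At.
have := tau_euler n t; rewrite At mul0r mulr0.
have a0 := IH1 t; have b0 := IH1 (t - 1).
have [k hk] := flim_logderiv a0; have [l hl] := flim_logderiv b0.
move=> eq0.
(* If T_(n+1) vanished, [tau_euler] divided by T_n(s) T_n(s-1) could be solved for x, giving x a
   finite limit at infinity. *)
suff: x = - (cF (t + 2^-1 + n%:R) + x * L (T n (t - 1)) - x * L (T n t)) / (2 * E).
  move=> Ex; have : flim x (- (t + 2^-1 + n%:R + l%:~R - k%:~R) / (2 * eps)).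
    rewrite Ex -(cF_nat _ 2) -cFM; apply: flimM.
      by apply: flimN; apply: flimB hk; apply: flimD hl; apply: flim_cF.
    by apply: flimV (flim_cF _); rewrite mulf_neq0 ?pnatr_eq0.
  exact: flim_xF.
move: eq0 a0 b0 cF_eps_neq0 (K_nat_neq0 1); clear.
move: (T n t) (fderiv (T n t)) (T n (t - 1)) (fderiv (T n (t - 1))) x E (cF (t + 2^-1 + n%:R)).
clear; suff H (F : fieldType) (a a' b b' x e m : F) :
  0 = (m + 2 * (e * x)) * (a * b) + x * (a * b' - a' * b) -> a != 0 -> b != 0 ->
  e != 0 -> 2 != 0 :> F -> x = - (m + x * (b' / b) - x * (a' / a)) / (2 * e).
  exact: (H K).
move=> eq0 a0 b0 e0 two0.
have -> : - (m + x * (b' / b) - x * (a' / a)) / (2 * e) = x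
  - ((m + 2 * (e * x)) * (a * b) + x * (a * b' - a' * b)) / (2 * e * a * b).
  by field; rewrite two0 a0 b0 e0.
by rewrite -eq0 mul0r subr0.
Qed.

Definition rho n s := T n.+1 (s - 1) * T n s / (T n.+1 s * T n (s - 1)).

Lemma rho_neq0 n s : rho n s != 0.
Proof. by rewrite /rho !mulf_neq0 ?invr_eq0 ?mulf_neq0 ?tau_neq0. Qed.

(** [Upos_lower] divided by 2 T_(n+1)(s) T_n(s-1). *)
Lemma rhoE n s : rho n s = 1 + (L (T n (s - 1)) - L (T n.+1 s)) / (2 * E).
Proof.
have := congr1 (scaled eps) (Upos_lower n s).
rewrite !scaledE !scaled_deriv -!/(tau eps _ _) /rho.
have := tau_neq0 n.+1 s; have := tau_neq0 n (s - 1).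
have := cF_eps_neq0; have := K_nat_neq0 1.
move: (T n.+1 s) (T n.+1 (s - 1)) (T n s) (T n (s - 1)) (fderiv (T n.+1 s))
  (fderiv (T n (s - 1))) E.
clear; suff H (F : fieldType) (a b c d a' d' e : F) : 2 != 0 :> F -> e != 0 -> d != 0 -> a != 0 ->
  c * b * 2 = 2 * (a * d) + a * (d' / e) - a' / e * d ->
  b * c / (a * d) = 1 + (d' / d - a' / a) / (2 * e).
  exact: (H K).
move=> h0 h1 h2 h3 eq0.
have -> : b * c / (a * d) = c * b * 2 / (2 * (a * d)) by field; rewrite h0 h2 h3.
by rewrite eq0; field; rewrite h0 h1 h2 h3.
Qed.

(** [Upos_raise] divided by 2 T_(n+1)(s-1) T_n(s). *)
Lemma rhoVE n s : (rho n s)^-1 = 1 + (L (T n.+1 (s - 1)) - L (T n s)) / (2 * E).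
Proof.
have := congr1 (scaled eps) (Upos_raise n s).
rewrite !scaledE !scaled_deriv -!/(tau eps _ _) /rho invf_div.
have := tau_neq0 n.+1 (s - 1); have := tau_neq0 n s.
have := cF_eps_neq0; have := K_nat_neq0 1.
move: (T n.+1 s) (T n.+1 (s - 1)) (T n s) (T n (s - 1)) (fderiv (T n.+1 (s - 1)))
  (fderiv (T n s)) E.
clear; suff H (F : fieldType) (a b c d b' c' e : F) : 2 != 0 :> F -> e != 0 -> c != 0 -> b != 0 ->
  2 * (a * d) = 2 * (c * b) + c * (b' / e) - c' / e * b ->
  a * d / (b * c) = 1 + (b' / b - c' / c) / (2 * e).
  exact: (H K).
move=> h0 h1 h2 h3 eq0.
have -> : a * d / (b * c) = 2 * (a * d) / (2 * (b * c)) by field; rewrite h0 h2 h3.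
by rewrite eq0; field; rewrite h0 h1 h2 h3.
Qed.

Lemma log_rho n s : L (rho n s) =
  L (T n.+1 (s - 1)) + L (T n s) - L (T n.+1 s) - L (T n (s - 1)).
Proof.
by rewrite /rho fderiv_log_ratio ?tau_neq0 // opprD addrA.
Qed.

Lemma rho_flim n s : flim (rho n s) 1.
Proof.
rewrite rhoE -[X in flim _ X]addr0; apply: flimD; first exact: flim1.
rewrite -[X in flim _ X](mul0r (2 * eps)^-1); apply: flimM; last first.
  rewrite -(cF_nat _ 2) -cFM; apply: flimV (flim_cF _).
  by rewrite mulf_neq0 ?pnatr_eq0.
have log0 (f : K) : f != 0 -> flim (L f) 0.
  move=> f0; have [k /flim_divx] := flim_logderiv f0.
  by rewrite mulrAC divff ?mul1r ?xF_neq0.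
by rewrite -[X in flim _ X](subrr 0); apply: flimB; apply: log0; apply: tau_neq0.
Qed.

(* The left side of the fourth bilinear relation divided by ab; equating two
   expressions for its derivative gives the equation for [rho]. *)
Definition ups n s := (n.+1.*2.+1)%:R *
  (T n.+2 s * T n (s - 1) / (T n.+1 s * T n.+1 (s - 1))).

(** By [log_rho], [rhoE] and [rhoVE] the last bracket is 4E + 2(L b - L a) with a = T_(n+1)(s), b =
    T_(n+1)(s-1); the rest is twice [tau_euler] divided by ab. *)
Lemma ups_euler n s : 2 * ups n s = 2 * cF (s + 2^-1 + n.+1%:R) +
   x * (L (rho n s) + 2 * E * (rho n s + (rho n s)^-1)).
Proof.
rewrite log_rho rhoVE rhoE /ups; have := tau_euler n.+1 s; rewrite -[n.+1.-1]/n.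
have := tau_neq0 n.+1 (s - 1); have := tau_neq0 n.+1 s.
have := cF_eps_neq0; have := K_nat_neq0 1.
move: (T n.+2 s) (T n (s - 1)) (T n.+1 s)
  (fderiv (T n.+1 s)) (T n.+1 (s - 1)) (fderiv (T n.+1 (s - 1))) E x
  (cF (s + 2^-1 + n.+1%:R)) (n.+1.*2.+1%:R : K) (L (T n s)) (L (T n (s - 1))).
clear; suff H (F : fieldType) (ta d a a' b b' e x m t lc ld : F) :
  2 != 0 :> F -> e != 0 -> a != 0 -> b != 0 ->
  t * (ta * d) = (m + 2 * (e * x)) * (a * b) + x * (a * b' - a' * b) ->
  2 * (t * (ta * d / (a * b))) = 2 * m + x * (b' / b + lc - a' / a - ld
    + 2 * e * (1 + (ld - a' / a) / (2 * e) + (1 + (b' / b - lc) / (2 * e)))).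
  exact: (H K).
move=> h0 h1 h2 h3 eq0; rewrite [t * _]mulrA eq0.
by field; rewrite h0 h1 h2 h3.
Qed.

(** With A, B of size n+2 and a, b of size n+1, [rhoE] and [Upos_lower] give L(ups) = 2E(rho -
    aB/(Ab)). The Plücker relation rewrites ups aB/(Ab) as (ups - (2n+3))/rho. *)
Lemma fderiv_ups n s : fderiv (ups n s) =
  2 * E * (ups n s * rho n s - (ups n s - n.+1.*2.+1%:R) / rho n s).
Proof.
have ups0 : ups n s != 0.
  by rewrite /ups -natr1 natr1 !mulf_neq0 ?invr_eq0 ?mulf_neq0 ?K_nat_neq0 ?tau_neq0.
have Lups : L (ups n s) = L (T n.+2 s) + L (T n (s - 1))
    - (L (T n.+1 s) + L (T n.+1 (s - 1))).
  have q0 : T n.+2 s * T n (s - 1) / (T n.+1 s * T n.+1 (s - 1)) != 0.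
    by rewrite !mulf_neq0 ?invr_eq0 ?mulf_neq0 ?tau_neq0.
  rewrite /ups (fderiv_logM (K_nat_neq0 _) q0) fderiv_log_ratio ?tau_neq0 //.
  by rewrite -[in L _%:R]cF_nat fderiv_cF mul0r add0r.
rewrite -[LHS](divfK ups0) Lups.
have := congr1 (scaled eps) (Upos_plucker n.+1 s).
have := congr1 (scaled eps) (Upos_lower n.+1 s).
have := rhoE n s; rewrite !scaledE !scaled_deriv -!/(tau eps _ _) {2 3}/rho -[n.+1.-1]/n /ups.
have := tau_neq0 n.+2 s; have := tau_neq0 n (s - 1); have := tau_neq0 n s.
have := tau_neq0 n.+1 (s - 1); have := tau_neq0 n.+1 s.
have := cF_eps_neq0; have := K_nat_neq0 1; clear ups0.
rewrite /rho.
move: (T n.+2 s) (fderiv (T n.+2 s)) (T n.+2 (s - 1)) (T n.+1 s) (fderiv (T n.+1 s))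
  (T n.+1 (s - 1)) (fderiv (T n.+1 (s - 1))) (T n s) (T n (s - 1)) (fderiv (T n (s - 1)))
  E (n.+1.*2.+1%:R : K).
clear; suff H (F : fieldType) (ta ta' tb a a' b b' c d d' e t : F) :
  2 != 0 :> F -> e != 0 -> a != 0 -> b != 0 -> c != 0 -> d != 0 -> ta != 0 ->
  b * c / (a * d) = 1 + (d' / d - a' / a) / (2 * e) ->
  a * tb * 2 = 2 * (ta * b) + ta * (b' / e) - ta' / e * b ->
  ta * d = a * b + c * tb ->
  (ta' / ta + d' / d - (a' / a + b' / b)) * (t * (ta * d / (a * b))) =
  2 * e * (t * (ta * d / (a * b)) * (b * c / (a * d))
    - (t * (ta * d / (a * b)) - t) / (b * c / (a * d))).
  exact: (H K).
move=> h2 e0 a0 b0 c0 d0 A0 hrho hlow hpl.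
have -> : t * (ta * d / (a * b)) - t = t * ((ta * d - a * b) / (a * b)).
  by field; rewrite a0 b0.
have -> : ta * d - a * b = c * tb by rewrite hpl addrAC subrr add0r.
have -> : ta' / ta + d' / d - (a' / a + b' / b) =
  2 * e * (1 + (d' / d - a' / a) / (2 * e) - 1
   + (1 - (2 * (ta * b) + ta * (b' / e) - ta' / e * b) / (2 * (ta * b)))).
  by field; rewrite h2 e0 a0 b0 d0 A0.
by rewrite -hrho -hlow; field; rewrite h2 a0 b0 c0 d0 A0.
Qed.

(** Differentiate [ups_euler], insert [fderiv_ups] on the left, and eliminate ups by [ups_euler]
    itself. *)
Lemma rho_ode n s :
  x * fderiv (L (rho n s)) + L (rho n s) =
  2 * E * (2 * (cF s + n.+1%:R) * rho n s + 2 * (n.+1%:R - cF s) / rho n s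
   + 2 * E * x * (rho n s ^+ 2 - rho n s ^- 2)).
Proof.
have hm : 2 * cF (s + 2^-1 + n.+1%:R) = 2 * cF s + 1 + 2 * n.+1%:R.
  have h : 2 * cF 2^-1 = 1 :> K.
    by rewrite -(cF_nat _ 2) -cFM divff ?pnatr_eq0 // cF1.
  by rewrite !cFD cF_nat !mulrDr h.
have e1 := ups_euler n s; rewrite hm in e1.
have := congr1 (@fderiv C) e1.
have fn m (f : K) : fderiv (m%:R * f) = m%:R * fderiv f.
  by rewrite -cF_nat fderiv_cFM.
have -> : 2 * cF s + 1 + 2 * n.+1%:R = cF (2 * s + 1 + 2 * n.+1%:R) :> K.
  by rewrite !cFD !cFM !cF_nat cF1.
rewrite fn fderiv_ups fderivD fderiv_cF add0r fderivM fderiv_xF mul1r fderivD.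
rewrite -[2 * E * (rho n s + _)]mulrA fn fderiv_cFM fderivD fderivV.
have fr : fderiv (rho n s) = rho n s * L (rho n s).
  by rewrite mulrC (divfK (rho_neq0 n s)).
set l := L (rho n s) in e1 fr *; clearbody l; rewrite {}fr.
have -> : n.+1.*2.+1%:R = 2 * n.+1%:R + 1 :> K by rewrite -natr1 -mul2n natrM.
move: e1 (rho_neq0 n s) cF_eps_neq0 (K_nat_neq0 1).
move: (ups n s) E x (cF s) (n.+1%:R : K) (rho n s) l (fderiv l).
clear; suff H (F : fieldType) (u e x s n r l l' : F) :
  2 * u = 2 * s + 1 + 2 * n + x * (l + 2 * e * (r + r^-1)) -> r != 0 -> e != 0 ->
  2 != 0 :> F ->
  2 * (2 * e * (u * r - (u - (2 * n + 1)) / r)) =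
  l + 2 * (e * (r + r^-1)) + x * (l' + 2 * (e * (r * l + - (r * l) / r ^+ 2))) ->
  x * l' + l = 2 * e * (2 * (s + n) * r + 2 * (n - s) / r + 2 * e * x * (r ^+ 2 - r ^- 2)).
  exact: (H K).
move=> eu r0 e0 h2 eq0.
have -> : x * l' + l = 2 * e * ((2 * u) * (r - r^-1) + (2 * (2 * n + 1)) / r)
   - 2 * e * (r + r^-1) - x * (2 * e * (r * l - l / r)).
  have -> : 2 * e * ((2 * u) * (r - r^-1) + (2 * (2 * n + 1)) / r) =
    2 * (2 * e * (u * r - (u - (2 * n + 1)) / r)) by field.
  by rewrite eq0; field.
by rewrite eu; field.
Qed.

(** Dividing rho by E normalises the coefficient of x: since E^4 = 1, (rho/E)^2 - (rho/E)^-2 = E^2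
    (rho^2 - rho^-2). *)
Lemma rho_PIIIlog n s : eps ^+ 4 = 1 ->
  PIIIlog (4 * eps ^+ 2 * (s + n.+1%:R)) (4 * (n.+1%:R - s)) (rho n s / E).
Proof.
move=> eps4; split; first by rewrite mulf_neq0 ?invr_eq0 ?rho_neq0 ?cF_eps_neq0.
have -> : L (rho n s / E) = L (rho n s).
  rewrite fderiv_logM ?rho_neq0 ?invr_eq0 ?cF_eps_neq0 // fderiv_logV ?cF_eps_neq0 //.
  by rewrite fderiv_cF mul0r oppr0 addr0.
rewrite rho_ode.
have -> : cF (4 * eps ^+ 2 * (s + n.+1%:R)) = 4 * E ^+ 2 * (cF s + n.+1%:R).
  by rewrite !expr2 !cFM cFD !cF_nat.
have -> : cF (4 * (n.+1%:R - s)) = 4 * (n.+1%:R - cF s).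
  by rewrite cFM (cF_nat _ 4) cFD cFN cF_nat.
have : E ^+ 4 = 1 by rewrite /cF -tofracXn -rmorphXn /= eps4 tofrac1.
move: (rho_neq0 n s) cF_eps_neq0.
move: (rho n s) E x (cF s) (n.+1%:R : K).
clear; suff H (F : fieldType) (r e x s n : F) : r != 0 -> e != 0 -> e ^+ 4 = 1 ->
  2 * e * (2 * (s + n) * r + 2 * (n - s) / r + 2 * e * x * (r ^+ 2 - r ^- 2)) =
  4 * e ^+ 2 * (s + n) * (r / e) + 4 * (n - s) / (r / e)
  + 4 * x * ((r / e) ^+ 2 - (r / e) ^- 2).
  exact: (H K).
move=> r0 e0 e4.
have -> : (r / e) ^+ 2 - (r / e) ^- 2 = e ^+ 2 * (r ^+ 2 / e ^+ 4 - r ^- 2).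
  by field; rewrite r0 e0.
by rewrite e4 invr1 mulr1; field; rewrite r0 e0.
Qed.

End Scale.
End Existence.

(** * Classification *)

Section Classification.
Variable C : numClosedFieldType.
Local Notation K := {fraction {poly C}}.
Local Notation x := (xF C).
Implicit Types (s e c alpha beta : C) (n : nat) (N : int) (v : K).

Lemma fourth_root_sq c : c ^+ 4 = 1 -> c ^+ 2 = 1 \/ c ^+ 2 = -1.
Proof. by move/eqP; rewrite (exprM c 2 2) sqrf_eq1 => /orP[]/eqP; [left | right]. Qed.

Lemma fourth_root_neq0 c : c ^+ 4 = 1 -> c != 0.
Proof. by move=> c4; apply/eqP => c0; move/eqP: c4; rewrite c0 expr0n eq_sym oner_eq0. Qed.

Lemma coprime_frac v : v != 0 ->
  exists P Q, [/\ coprimep P Q, P != 0, Q != 0 & v = P%:F / Q%:F].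
Proof.
have [n [d [d0 ->]]] := fracP v => v0.
have n0 : n != 0 by apply: contraNneq v0 => ->; rewrite tofrac0 mul0r.
exists (n %/ gcdp n d), (d %/ gcdp n d); split.
- by rewrite coprimep_div_gcd // n0.
- by rewrite dvdp_div_eq0 ?dvdp_gcdl.
- by rewrite dvdp_div_eq0 ?dvdp_gcdr.
apply/eqP; rewrite eq_frac // ?dvdp_div_eq0 ?dvdp_gcdr //; apply/eqP.
move: (divpK (dvdp_gcdl n d)) (divpK (dvdp_gcdr n d)); move: (gcdp n d) => g en ed.
by rewrite -{1}en -{2}ed; ring.
Qed.

(** By coprimality 0 is not a pole of both v and 1/v, so the residue argument applies to one of
    them. *)
Lemma PIIIlog_integer alpha beta v c : PIIIlog alpha beta v -> c ^+ 4 = 1 ->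
  flim v c -> exists N, alpha + beta * c ^+ 2 = 8 * N%:~R.
Proof.
move=> h c4 hc; have c0 := fourth_root_neq0 c4.
have [P [Q [co P0 Q0 e]]] := coprime_frac (proj1 h); move: h hc; rewrite {}e => h hc.
have [Qz|Qz] := eqVneq Q.[0] 0; last first.
  have [k hk] := PIIIlog_integer_residues co Qz h hc.
  by exists (- k); rewrite (PIIIlog_coef h c4 hc hk) mulrNz mulrN mulNr.
have Pz : P.[0] != 0 by apply: (@coprimep_root _ Q); [rewrite coprimep_sym | apply/rootP].
have h' := PIIIlogV h; have hc' := flimV c0 hc; rewrite invf_div in h' hc'.
rewrite coprimep_sym in co.
have [k hk] := PIIIlog_integer_residues co Pz h' hc'.
have c4' : c^-1 ^+ 4 = 1 by rewrite exprVn c4 invr1.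
(* For 1/v the relation reads -beta - alpha c^-2 = -8k; hence N = k if c^2 = 1 and N = -k if c^2 =
   -1. *)
have := PIIIlog_coef h' c4' hc' hk; rewrite exprVn.
case: (fourth_root_sq c4) => ->.
  rewrite invr1 !mulr1 => ek; exists k.
  by apply: oppr_inj; rewrite opprD addrC ek mulNr.
rewrite invrN1 => ek; exists (- k); rewrite mulrNz [RHS]mulrN -[RHS]mulNr -ek.
by ring.
Qed.

Definition ratio e N s : K := scaled e (U N (s - 1)) * scaled e (U (N - 1) s)
  / (scaled e (U N s) * scaled e (U (N - 1) (s - 1))).

Lemma ratio0 e s : ratio e 0 s = 1.
Proof.
rewrite /ratio /= !mul1r /Upos !det_mx00 -[1]/(1%:R) scaled_nat.
by rewrite !mulr1 divr1.
Qed.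

Lemma ratio_pos e n s : ratio e n.+1%:Z s = rho e n s.
Proof. by rewrite /ratio (_ : n.+1%:Z - 1 = n%:Z) //; lia. Qed.

(** For N = -n-1 the polynomials U_N and U_(N-1) are, up to sign, U_n and U_(n+1); each sign occurs
    above and below, and the quotient is inverted. *)
Lemma ratio_neg e n s : ratio e (Negz n) s = (rho e n s)^-1.
Proof.
rewrite /ratio (_ : Negz n - 1 = Negz n.+1); last by lia.
rewrite /= !scaledM /rho invf_div.
have sgn m : scaled e ((-1) ^+ m) != 0.
  rewrite -signr_odd; case: odd; last by rewrite -[_ ^+ _]/(1%:R) scaled_nat oner_eq0.
  by rewrite expr1 scaledN -[1]/(1%:R) scaled_nat oppr_eq0 oner_eq0.
move: (sgn ((n * n.+1) %/ 2)%N) (sgn ((n.+1 * n.+2) %/ 2)%N).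
rewrite -!/(tau e _ _).
move: (scaled e ((-1) ^+ ((n * n.+1) %/ 2)%N)) (scaled e ((-1) ^+ ((n.+1 * n.+2) %/ 2)%N)).
move: (tau e n s) (tau e n (s - 1)) (tau e n.+1 s) (tau e n.+1 (s - 1)).
suff H (F : fieldType) (a b c d t u : F) : t != 0 -> u != 0 ->
  t * b * (u * c) / (t * a * (u * d)) = c * b / (d * a).
  exact: (H K).
move=> t0 u0; rewrite (_ : t * b * (u * c) = (t * u) * (c * b)); last by ring.
rewrite (_ : t * a * (u * d) = (t * u) * (d * a)); last by ring.
by rewrite -mulf_div divff ?mul1r // mulf_neq0.
Qed.

Lemma ratio_flim e N s : e != 0 -> flim (ratio e N s) 1.
Proof.
move=> e0; case: N => [[|n]|n].
- by rewrite ratio0; apply: flim1.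
- by rewrite ratio_pos; apply: rho_flim.
by rewrite ratio_neg -invr1; apply: flimV (rho_flim e0 _ _); rewrite oner_eq0.
Qed.

(** N = 0 is the constant solution 1/e. For N < 0 invert a solution with positive index: (rho/E)^-1
    = E^2 (rho^-1/E), where E^2 = -1 calls for one further change of sign. *)
Lemma ratio_PIIIlog e N s : e ^+ 4 = 1 ->
  PIIIlog (4 * e ^+ 2 * (s + N%:~R)) (4 * (N%:~R - s)) (ratio e N s / cF e).
Proof.
move=> e4; have e0 := fourth_root_neq0 e4.
case: N => [[|n]|n].
- rewrite ratio0 div1r addr0 sub0r; split.
    by rewrite invr_eq0 cF_eps_neq0.
  rewrite fderivV fderiv_cF oppr0 !mul0r fderiv0 mulr0 addr0.
  have E4 : cF e ^+ 4 = 1 by rewrite /cF -tofracXn -rmorphXn /= e4 tofrac1.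
  rewrite !expr2 !cFM cFN (cF_nat _ 4).
  move: E4 (cF_eps_neq0 e0); move: (cF e) (cF s) x.
  suff H (F : fieldType) (a b y : F) : a ^+ 4 = 1 -> a != 0 ->
    0 = 4 * (a * a) * b * a^-1 + 4 * (- b) / a^-1 + 4 * y * (a^-1 * a^-1 - (a^-1 * a^-1)^-1).
    exact: (H K).
  move=> a4 a0; have -> : a^-1 * a^-1 = a ^+ 2 / a ^+ 4 by field.
  rewrite a4 divr1; have -> : (a ^+ 2)^-1 = a ^+ 2 / a ^+ 4 by field.
  by rewrite a4 divr1 invrK; field.
- by rewrite ratio_pos; apply: rho_PIIIlog.
rewrite ratio_neg; have := PIIIlogV (rho_PIIIlog e0 n s e4).
have E2 : cF e ^+ 2 = cF (e ^+ 2) by rewrite expr2 cFM.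
have E0 := cF_eps_neq0 e0; have r0 := rho_neq0 e0 n s.
have -> : (rho e n s / cF e)^-1 = cF e ^+ 2 * ((rho e n s)^-1 / cF e).
  move: (rho e n s) (cF e) E0 r0.
  clear; suff H (F : fieldType) (r a : F) : a != 0 -> r != 0 ->
    (r / a)^-1 = a ^+ 2 * (r^-1 / a) by exact: H.
  by move=> h h'; field; rewrite h h'.
have -> : (Negz n)%:~R = - n.+1%:R :> C by rewrite NegzE mulrNz.
rewrite {}E2; case: (fourth_root_sq e4) => ->.
  rewrite cF1 mul1r; congr PIIIlog; ring.
move/PIIIlogN; rewrite cFN cF1 mulN1r opprK; congr PIIIlog; ring.
Qed.

(** * The four families: their equations and their limits *)

Lemma scaled1 p : scaled 1 p = p%:F :> K.
Proof. by rewrite /scaled scale1r comp_polyXr. Qed.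

Lemma UF_ratio N s : UF N (s - 1) * UF (N - 1) s / (UF N s * UF (N - 1) (s - 1))
  = ratio 1 N s / cF 1.
Proof. by rewrite cF1 divr1 /ratio !scaled1. Qed.

Lemma UF_ratioV N s : - (UF N (- s) * UF (N - 1) (- s - 1)
  / (UF N (- s - 1) * UF (N - 1) (- s))) = - (ratio 1 N (- s) / cF 1)^-1.
Proof. by rewrite -UF_ratio invf_div. Qed.

Lemma UFi_ratio N s : cF 'i * (UFi N (s - 1) * UFi (N - 1) s
    / (UFi N s * UFi (N - 1) (s - 1))) = ratio 'i^-1 N s / cF 'i^-1.
Proof.
have h : cF 'i * cF 'i^-1 = 1 :> K by rewrite -cFM divff ?neq0Ci // cF1.
apply: (canRL (mulfK _)); first by rewrite cF_eps_neq0 // invr_eq0 neq0Ci.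
by rewrite mulrAC h mul1r.
Qed.

Lemma UFi_ratioV N s : - cF 'i * (UFi N s * UFi (N - 1) (s - 1)
  / (UFi N (s - 1) * UFi (N - 1) s)) = (ratio 'i^-1 N s / cF 'i^-1)^-1.
Proof. by rewrite -cFN -invCi invf_div -[RHS]mulrC invf_div mulrC mulrC. Qed.

Lemma UF_PIIIlog N s : PIIIlog (4 * (s + N%:~R)) (4 * (N%:~R - s))
  (UF N (s - 1) * UF (N - 1) s / (UF N s * UF (N - 1) (s - 1))).
Proof.
have := ratio_PIIIlog N s (expr1n C 4); rewrite -UF_ratio.
by rewrite expr1n mulr1.
Qed.

(** The map v -> -1/v exchanges alpha and beta, and s -> -s exchanges them back. *)
Lemma UFV_PIIIlog N s : PIIIlog (4 * (s + N%:~R)) (4 * (N%:~R - s))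
  (- (UF N (- s) * UF (N - 1) (- s - 1) / (UF N (- s - 1) * UF (N - 1) (- s)))).
Proof.
rewrite UF_ratioV -UF_ratio; have /PIIIlogV/PIIIlogN := UF_PIIIlog N (- s).
rewrite !opprK; congr PIIIlog; ring.
Qed.

Lemma iV4 : 'i^-1 ^+ 4 = 1 :> C.
Proof. by rewrite exprVn (exprM _ 2 2) sqrCi sqrrN expr1n invr1. Qed.

Lemma iV2 : 'i^-1 ^+ 2 = -1 :> C.
Proof. by rewrite exprVn sqrCi invrN1. Qed.

Lemma UFi_PIIIlog N s : PIIIlog (- 4 * (s + N%:~R)) (4 * (N%:~R - s))
  (cF 'i * (UFi N (s - 1) * UFi (N - 1) s / (UFi N s * UFi (N - 1) (s - 1)))).
Proof.
rewrite UFi_ratio; have := ratio_PIIIlog N s iV4.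
by rewrite iV2 mulrN1.
Qed.

Lemma UFiV_PIIIlog N s : PIIIlog (- 4 * (s + N%:~R)) (4 * (N%:~R - s))
  (- cF 'i * (UFi N (- s) * UFi (N - 1) (- s - 1)
              / (UFi N (- s - 1) * UFi (N - 1) (- s)))).
Proof.
rewrite UFi_ratioV -UFi_ratio; have /PIIIlogV := UFi_PIIIlog N (- s).
congr PIIIlog; ring.
Qed.

(** The limits 1, -1, 'i, -'i of the four families exhaust the fourth roots of unity, so some family
    meets every possible limit of a solution. *)
Lemma UF_flim N s :
  flim (UF N (s - 1) * UF (N - 1) s / (UF N s * UF (N - 1) (s - 1))) 1.
Proof. by rewrite UF_ratio cF1 divr1; apply: ratio_flim; rewrite oner_eq0. Qed.

Lemma UFV_flim N s : flim (- (UF N (- s) * UF (N - 1) (- s - 1)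
  / (UF N (- s - 1) * UF (N - 1) (- s)))) (-1).
Proof.
rewrite UF_ratioV -UF_ratio -[X in flim _ (- X)]invr1; apply: flimN.
by apply: flimV (UF_flim _ _); rewrite oner_eq0.
Qed.

Lemma UFi_flim N s : flim (cF 'i * (UFi N (s - 1) * UFi (N - 1) s
  / (UFi N s * UFi (N - 1) (s - 1)))) 'i.
Proof.
rewrite -[X in flim _ X]mulr1; apply: flimM (flim_cF _) _.
by apply: (ratio_flim N s); rewrite invr_eq0 neq0Ci.
Qed.

Lemma UFiV_flim N s : flim (- cF 'i * (UFi N (- s) * UFi (N - 1) (- s - 1)
  / (UFi N (- s - 1) * UFi (N - 1) (- s)))) (- 'i).
Proof.
rewrite UFi_ratioV -UFi_ratio -invCi; apply: flimV (UFi_flim _ _).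
exact: neq0Ci.
Qed.

End Classification.

(** * The complete list of rational solutions *)

Unset Implicit Arguments. Set Strict Implicit. Set Printing Implicit Defensive.

Theorem theorem3 (C : numClosedFieldType) (thinf th0 : C)
    (v : {fraction {poly C}}) :
  PIII (- 4 * thinf) (4 * (th0 + 1)) 4 (- 4) v <->
  [\/ exists (s : C) (N : int),
        (thinf = - s - N%:~R /\ th0 = - s + N%:~R - 1) /\
        (v = UF N (s - 1) * UF (N - 1) s / (UF N s * UF (N - 1) (s - 1)) \/
         v = - (UF N (- s) * UF (N - 1) (- s - 1)
                / (UF N (- s - 1) * UF (N - 1) (- s)))),
      exists (s : C) (N : int),
        (thinf = s + N%:~R /\ th0 = - s + N%:~R - 1) /\
        (v = cF 'i * (UFi N (s - 1) * UFi (N - 1) s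
                      / (UFi N s * UFi (N - 1) (s - 1))) \/
         v = - cF 'i * (UFi N (- s) * UFi (N - 1) (- s - 1)
                        / (UFi N (- s - 1) * UFi (N - 1) (- s))))
    | exists M N : int,
        (thinf = - M%:~R - N%:~R /\ th0 = - M%:~R + N%:~R - 1) /\
        [\/ v = UF N (M%:~R - 1) * UF (N - 1) M%:~R
                / (UF N M%:~R * UF (N - 1) (M%:~R - 1)),
            v = - (UF N (- M%:~R) * UF (N - 1) (- M%:~R - 1)
                   / (UF N (- M%:~R - 1) * UF (N - 1) (- M%:~R))),
            v = cF 'i * (UFi M (- N%:~R) * UFi (M - 1) (- N%:~R - 1)
                         / (UFi M (- N%:~R - 1) * UFi (M - 1) (- N%:~R)))
          | v = - cF 'i * (UFi M (N%:~R - 1) * UFi (M - 1) N%:~R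
                           / (UFi M N%:~R * UFi (M - 1) (N%:~R - 1)))]].
Proof.
have real s N : - 4 * (- s - N%:~R) = 4 * (s + N%:~R) /\
    4 * (- s + N%:~R - 1 + 1) = 4 * (N%:~R - s) :> C by split; ring.
rewrite PIII_log; split; last first.
  case=> [[s [N [[-> ->]]]]|[s [N [[-> ->]]]]|[M [N [[-> ->]]]]].
  - by have [-> ->] := real s N; case=> ->; [exact: UF_PIIIlog | exact: UFV_PIIIlog].
  - by have [_ ->] := real s N; case=> ->; [exact: UFi_PIIIlog | exact: UFiV_PIIIlog].
  have [-> ->] := real M%:~R N; case=> ->; first exact: UF_PIIIlog.
  - exact: UFV_PIIIlog.
  (* The last two formulas are the second kind with index M and parameter N, followed by v -> -v. *)
  - have := PIIIlogN (UFiV_PIIIlog M (N%:~R : C)).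
    by rewrite !mulNr !opprK -[- (4 * _)]mulrN opprB [_ + M%:~R]addrC.
  have := PIIIlogN (UFi_PIIIlog M (N%:~R : C)).
  by rewrite !mulNr opprK -[- (4 * _)]mulrN opprB [_ + M%:~R]addrC.
move=> h; have [c [c4 hc]] := PIIIlog_limit h.
have [N hN] := PIIIlog_integer h c4 hc.
have n4 : 4 != 0 :> C by rewrite pnatr_eq0.
have [c2|c2] := fourth_root_sq c4; rewrite c2 in hN.
(* For c^2 = 1, alpha + beta = 8N fixes th0, and s = -thinf - N; the sign of c selects the
   formula. *)
- have e0 : th0 = - (- thinf - N%:~R) + N%:~R - 1.
    have : 4 * (th0 + 1) = 8 * N%:~R + 4 * thinf by rewrite -hN; ring.
    rewrite (_ : 8 * _ + _ = 4 * (2 * N%:~R + thinf)); last by ring.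
    by move/(mulfI n4)/(canRL (addrK _)) ->; ring.
  apply: Or31; exists (- thinf - N%:~R), N; split; first by split=> //; ring.
  have [ea eb] := real (- thinf - N%:~R) N.
  rewrite -e0 (_ : - (- thinf - N%:~R) - N%:~R = thinf) in ea eb; last by ring.
  rewrite ea eb in h; move/eqP: c2 c4 hc; rewrite sqrf_eq1 => /orP[]/eqP -> c4 hc.
    left; exact: PIIIlog_unique c4 h (UF_PIIIlog _ _) hc (UF_flim _ _).
  right; exact: PIIIlog_unique c4 h (UFV_PIIIlog _ _) hc (UFV_flim _ _).
(* For c^2 = -1, alpha - beta = 8N; the index of the family is -N and s = thinf + N. *)
have e0 : th0 = - (thinf + N%:~R) - N%:~R - 1.
  have : 4 * (th0 + 1) = - (8 * N%:~R) - 4 * thinf by rewrite -hN; ring.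
  rewrite (_ : - (8 * _) - _ = 4 * (- 2 * N%:~R - thinf)); last by ring.
  by move/(mulfI n4)/(canRL (addrK _)) ->; ring.
have [_] := real (thinf + N%:~R) (- N); rewrite mulrNz -e0 => eb.
apply: Or32; exists (thinf + N%:~R), (- N); rewrite mulrNz.
split; first by split=> //; ring.
have ea : - 4 * thinf = - 4 * (thinf + N%:~R + (- N)%:~R) by rewrite mulrNz addrK.
rewrite -mulrNz in eb; rewrite ea eb in h.
have /orP[/eqP ec|/eqP ec] : (c == 'i) || (c == - 'i) by rewrite -eqf_sqr c2 sqrCi.
  left; rewrite ec in c4 hc; exact: PIIIlog_unique c4 h (UFi_PIIIlog _ _) hc (UFi_flim _ _).
right; rewrite ec in c4 hc; exact: PIIIlog_unique c4 h (UFiV_PIIIlog _ _) hc (UFiV_flim _ _).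
Qed.
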